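(* Let $w\in W_a$. For an expression $w=s_{i_1}\cdots s_{i_n}$ of $w$ as a product of simple reflections in $S_a=\{s_0,\dots,s_r\}$ (not necessarily reduced), consider the element $$\Psi(w):=T_{s_{i_1}}^{\varepsilon_1}\cdots T_{s_{i_n}}^{\varepsilon_n}\in\mathcal H,$$ where the signs $\varepsilon_\nu\in\{\pm1\}$ are determined as follows. For each $\nu\in\{1,\dots,n\}$ let $\mathbf c_\nu:=s_{i_1}\cdots s_{i_{\nu-1}}\mathbf a$, and let $H_\nu$ be the affine root hyperplane containing the face of type $i_\nu$ of $\mathbf c_\nu$. Let $\mathbf b$ be an alcove far out in the anti-dominant chamber, i.e. such that for every $\nu$, writing $H_\nu=H_{\alpha,j}$ with $\alpha\in R$ a positive root and $j\in\mathbb Z$, one has $\mathbf b\subset\{x:\langle\alpha,x\rangle<j\}$. Set $\varepsilon_\nu=1$ if $\mathbf c_\nu$ lies on the same side of $H_\nu$ as $\mathbf b$, and $\varepsilon_\nu=-1$ otherwise. Then the element $\Psi(w)$ is independent of the choice of the expression $w=s_{i_1}\cdots s_{i_n}$.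
   Context: Let $(X^*,X_*,R,R^\vee,\Delta)$ be a reduced and irreducible based root datum, $\Delta$ the set of simple roots, $r=\#\Delta$, $W$ the finite Weyl group, generated by the simple reflections $s_1,\dots,s_r$, and $\widetilde W=X_*\rtimes W$ the extended affine Weyl group, acting on $X_{*,\mathbb R}=X_*\otimes\mathbb R$; $\epsilon^\lambda\in\widetilde W$ denotes the translation by $\lambda\in X_*$. Let $\alpha_0$ be the highest root, $s_0=\epsilon^{\alpha_0^\vee}s_{\alpha_0}$, $S_a=\{s_0,\dots,s_r\}$, and $W_a\subseteq\widetilde W$ the affine Weyl group generated by $S_a$; $(W_a,S_a)$ is a Coxeter system. The affine root hyperplanes are $H_{\alpha,n}=\{x\in X_{*,\mathbb R}:\langle\alpha,x\rangle=n\}$ for $\alpha\in R$, $n\in\mathbb Z$. Alcoves are the connected components of the complement of the union of all affine root hyperplanes in $X_{*,\mathbb R}$; the base alcove $\mathbf a$ is the alcove in the dominant Weyl chamber whose closure contains the origin. $W_a$ acts simply transitively on alcoves. For $i\in\{0,\dots,r\}$, the face of type $i$ of $\mathbf a$ is the face contained in the hyperplane fixed by $s_i$; the face of type $i$ of $x\mathbf a$ ($x\in W_a$) is the image under $x$ of the face of type $i$ of $\mathbf a$. Length function on $\widetilde W$: $\ell(w\epsilon^\lambda)=\sum_{\alpha>0,\,w(\alpha)<0}|\langle\alpha,\lambda\rangle+1|+\sum_{\alpha>0,\,w(\alpha)>0}|\langle\alpha,\lambda\rangle|$ for $w\in W$, $\lambda\in X_*$; it extends the Coxeter length on $W_a$.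 Fix a commutative ring $k$, an invertible element $v\in k$, and put $q=v^2$. The braid group of $\widetilde W$ has generators $T_w$ ($w\in\widetilde W$) and relations $T_wT_{w'}=T_{ww'}$ whenever $\ell(ww')=\ell(w)+\ell(w')$. The affine Hecke algebra $\mathcal H$ is the quotient of the group algebra over $k$ of this braid group by the two-sided ideal generated by $(T_s+1)(T_s-q)$, $s\in S_a$; the image of $T_w$ in $\mathcal H$ is again denoted $T_w$ (it is invertible). *)

(* Defs.v *)
From HB Require Import structures.
From mathcomp Require Import all_boot all_order all_algebra.
From mathcomp Require Import all_classical all_reals topology normedtype.
From mathcomp Require Import finmap.
(* the notations of monalg clash with those of topology *)
From mathcomp Require Import -(notations) monalg.

Set Implicit Arguments.
Unset Strict Implicit.
Unset Printing Implicit Defensive.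

Import Order.TTheory GRing.Theory Num.Theory.
Import numFieldNormedType.Exports.

Local Open Scope classical_set_scope.
Local Open Scope ring_scope.
Local Open Scope quotient_scope.

Inductive gen_subgroup (G : groupType) (S : G -> Prop) : G -> Prop :=
| gen_subgroup_gen x : S x -> gen_subgroup S x
| gen_subgroup_one : gen_subgroup S 1%g
| gen_subgroup_mul x y :
    gen_subgroup S x -> gen_subgroup S y -> gen_subgroup S (x * y)%g
| gen_subgroup_inv x : gen_subgroup S x -> gen_subgroup S (x^-1)%g.

(** The group of all bijections of a (possibly infinite) type;
    [(f * g)%g] is [f \o g]. *)
Record symg (T : Type) := Symg {
  symg_fun :> T -> T;
  symg_inv : T -> T;
  symg_funK : cancel symg_fun symg_inv;
  symg_invK : cancel symg_inv symg_fun
}.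

Section SymmetricGroup.
Variable T : Type.

HB.instance Definition _ := gen_eqMixin (symg T).
HB.instance Definition _ := gen_choiceMixin (symg T).

Lemma symg_eqP (f g : symg T) : symg_fun f =1 symg_fun g -> f = g.
Proof.
move=> /funext; case: f g => [f f' fK f'K] [g g' gK g'K] /= fg.
have fg' : f' = g' by apply: funext => x; rewrite -{1}(g'K x) -fg fK.
by subst; congr Symg; apply: Prop_irrelevance.
Qed.

Definition symg1 : symg T := @Symg T id id (fun=> erefl) (fun=> erefl).
Definition symgM (f g : symg T) : symg T :=
  Symg (can_comp (@symg_funK _ f) (@symg_funK _ g))
       (can_comp (@symg_invK _ g) (@symg_invK _ f)).
Definition symgV (f : symg T) : symg T :=
  Symg (@symg_invK _ f) (@symg_funK _ f).

Fact symgA : associative symgM. Proof. by move=> f g h; apply: symg_eqP. Qed.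
Fact symg1g : left_id symg1 symgM. Proof. by move=> f; apply: symg_eqP. Qed.
Fact symgg1 : right_id symg1 symgM. Proof. by move=> f; apply: symg_eqP. Qed.
Fact symgVg : left_inverse symg1 symgV symgM.
Proof. by move=> f; apply: symg_eqP => x /=; rewrite symg_funK. Qed.
Fact symggV : right_inverse symg1 symgV symgM.
Proof. by move=> f; apply: symg_eqP => x /=; rewrite symg_invK. Qed.

HB.instance Definition _ :=
  isGroup.Build (symg T) symgA symg1g symgg1 symgVg symggV.
End SymmetricGroup.

(** The group presented by generators [X] and relations [rel]. A letter
    [(x, true)] stands for [x] and [(x, false)] for its inverse. *)
Section PresentedGroup.
Variables (X : Type) (rel : seq (X * bool) -> seq (X * bool) -> Prop).
Let word : Type := seq (X * bool).

Inductive pres_eq : word -> word -> Prop :=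
| pres_rel u v : rel u v -> pres_eq u v
| pres_cancel x e : pres_eq [:: (x, e); (x, ~~ e)] [::]
| pres_cat u u' v v' : pres_eq u u' -> pres_eq v v' -> pres_eq (u ++ v) (u' ++ v')
| pres_refl u : pres_eq u u
| pres_sym u v : pres_eq u v -> pres_eq v u
| pres_trans u v t : pres_eq u v -> pres_eq v t -> pres_eq u t.

Definition pres_word : Type := word.
HB.instance Definition _ := gen_eqMixin pres_word.
HB.instance Definition _ := gen_choiceMixin pres_word.

Definition pres_eqb (u v : pres_word) : bool := `[< pres_eq u v >].

Fact pres_eqb_refl : reflexive pres_eqb.
Proof. by move=> u; apply/asboolP/pres_refl. Qed.
Fact pres_eqb_sym : symmetric pres_eqb.
Proof. by move=> u v; apply/asboolP/asboolP; apply: pres_sym. Qed.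
Fact pres_eqb_trans : transitive pres_eqb.
Proof. by move=> v u t /asboolP uv /asboolP vt; apply/asboolP/(pres_trans uv). Qed.
Canonical pres_equiv := EquivRel pres_eqb pres_eqb_refl pres_eqb_sym pres_eqb_trans.

Definition pres_group : Type := {eq_quot pres_eqb}.
HB.instance Definition _ := Choice.on pres_group.
HB.instance Definition _ := EqQuotient.on pres_group.

Definition pres_gen (x : X) : pres_group := \pi_pres_group [:: (x, true)].

Definition word_inv (u : word) : word := rev [seq (l.1, ~~ l.2) | l <- u].

Definition pres_one : pres_group := \pi_pres_group [::].
Definition pres_mul (a b : pres_group) : pres_group := \pi_pres_group (repr a ++ repr b).
Definition pres_inv (a : pres_group) : pres_group := \pi_pres_group (word_inv (repr a)).

Fact pi_pres_eq (u v : pres_word) : pres_eq u v -> \pi_pres_group u = \pi v.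
Proof. by move=> uv; apply/eqmodP/asboolP. Qed.

Fact pres_repr (u : pres_word) : pres_eq (repr (\pi_pres_group u)) u.
Proof. by apply/asboolP; have /eqmodP := reprK (\pi_pres_group u). Qed.

Fact pres_mulE (u v : pres_word) :
  pres_mul (\pi u) (\pi v) = \pi_pres_group (u ++ v).
Proof. by apply: pi_pres_eq; apply: pres_cat; apply: pres_repr. Qed.

Fact word_invV (u : word) : pres_eq (word_inv u ++ u) [::].
Proof.
elim: u => [|[x e] u IHu]; first exact: pres_refl.
rewrite /word_inv /= rev_cons cat_rcons.
apply: pres_trans IHu; apply: pres_cat; first exact: pres_refl.
rewrite -[u in X in pres_eq _ X]cat0s -[_ :: _ :: u]/([:: (x, ~~ e); (x, e)] ++ u).
apply: pres_cat; last exact: pres_refl.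
by rewrite -{2}[e]negbK; apply: pres_cancel.
Qed.

Fact word_invK (u : word) : word_inv (word_inv u) = u.
Proof.
rewrite /word_inv map_rev revK -map_comp -[RHS]map_id.
by apply: eq_map => -[x e] /=; rewrite negbK.
Qed.

Fact pres_mulA : associative pres_mul.
Proof.
move=> a b c; rewrite -[a]reprK -[b]reprK -[c]reprK.
by rewrite !pres_mulE catA.
Qed.
Fact pres_mul1 : left_id pres_one pres_mul.
Proof. by move=> a; rewrite -[a]reprK pres_mulE. Qed.
Fact pres_1mul : right_id pres_one pres_mul.
Proof. by move=> a; rewrite -[a]reprK pres_mulE cats0. Qed.
Fact pres_mulV : left_inverse pres_one pres_inv pres_mul.
Proof.
move=> a; rewrite -{2}[a]reprK pres_mulE.
by apply: pi_pres_eq; apply: word_invV.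
Qed.
Fact pres_Vmul : right_inverse pres_one pres_inv pres_mul.
Proof.
move=> a; rewrite -{1}[a]reprK pres_mulE; apply: pi_pres_eq.
by rewrite -{1}[repr a]word_invK; apply: word_invV.
Qed.

HB.instance Definition _ :=
  isGroup.Build pres_group pres_mulA pres_mul1 pres_1mul pres_mulV pres_Vmul.
End PresentedGroup.

(** The group algebra [k[G]]: finitely supported functions [G -> k] with the
    convolution product. *)
Definition group_alg (k : comPzRingType) (G : groupType) : Type := malg G k.

Section GroupAlgebra.
Variables (k : comPzRingType) (G : groupType).
Local Notation A := (group_alg k G).

HB.instance Definition _ := GRing.Zmodule.on A.

Definition ga_basis (g : G) (c : k) : A := mkmalgU g c.

Definition ga_one : A := ga_basis 1%g 1.
Definition ga_mul (x y : A) : A :=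
  \sum_(g <- msupp x) \sum_(h <- msupp y)
     ga_basis (g * h)%g (mcoeff g x * mcoeff h y).

Local Open Scope fset_scope.

Fact ga_mullw (d1 d2 : {fset G}) (x y : A) :
  msupp x `<=` d1 -> msupp y `<=` d2 ->
  ga_mul x y = \sum_(g <- d1) \sum_(h <- d2)
     ga_basis (g * h)%g (mcoeff g x * mcoeff h y).
Proof.
move=> le_d1 le_d2; rewrite /ga_mul (big_fset_incl _ le_d1) /=.
  apply/eq_bigr=> g _; apply/big_fset_incl => // h _ /mcoeff_outdom ->.
  by rewrite mulr0 /ga_basis monalgU0.
move=> g _ /mcoeff_outdom xg.
by rewrite big1 // => h _; rewrite xg mul0r /ga_basis monalgU0.
Qed.

Fact ga_mulUU g h c d :
  ga_mul (ga_basis g c) (ga_basis h d) = ga_basis (g * h)%g (c * d).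
Proof. by rewrite (ga_mullw msuppU_le msuppU_le) !big_seq_fset1 !mcoeffUU. Qed.

Fact ga_mulDl : left_distributive ga_mul +%R.
Proof.
move=> x y z; rewrite [in RHS](ga_mullw (fsubsetUl _ (msupp y)) (fsubset_refl _)).
rewrite [in RHS](ga_mullw (fsubsetUr (msupp x) _) (fsubset_refl _)).
rewrite (ga_mullw (msuppD_le _ _) (fsubset_refl _)).
rewrite -big_split /=; apply/eq_bigr=> g _.
rewrite -big_split /=; apply/eq_bigr=> h _.
by rewrite mcoeffD mulrDl /ga_basis monalgUD.
Qed.

Fact ga_mulDr : right_distributive ga_mul +%R.
Proof.
move=> z x y; rewrite [in RHS](ga_mullw (fsubset_refl _) (fsubsetUl _ (msupp y))).
rewrite [in RHS](ga_mullw (fsubset_refl _) (fsubsetUr (msupp x) _)).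
rewrite (ga_mullw (fsubset_refl _) (msuppD_le _ _)).
rewrite -big_split /=; apply/eq_bigr=> g _.
rewrite -big_split /=; apply/eq_bigr=> h _.
by rewrite mcoeffD mulrDr /ga_basis monalgUD.
Qed.

Fact ga_mul0l : left_zero 0 ga_mul.
Proof. by move=> x; rewrite /ga_mul msupp0 big_seq_fset0. Qed.

Fact ga_mul0r : right_zero 0 ga_mul.
Proof. by move=> x; rewrite /ga_mul big1 // => g _; rewrite msupp0 big_seq_fset0. Qed.

Fact ga_suml (I : Type) (r : seq I) (F : I -> A) (y : A) :
  ga_mul (\sum_(i <- r) F i) y = \sum_(i <- r) ga_mul (F i) y.
Proof. exact: (big_morph (ga_mul^~ y) (fun _ _ => ga_mulDl _ _ _) (ga_mul0l _)). Qed.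

Fact ga_sumr (I : Type) (r : seq I) (F : I -> A) (y : A) :
  ga_mul y (\sum_(i <- r) F i) = \sum_(i <- r) ga_mul y (F i).
Proof. exact: (big_morph (ga_mul y) (fun _ _ => ga_mulDr _ _ _) (ga_mul0r _)). Qed.

Fact ga_mul1l : left_id ga_one ga_mul.
Proof.
move=> x; rewrite [x in LHS]monalgE ga_sumr [RHS]monalgE.
by apply: eq_bigr => g _; rewrite ga_mulUU mul1g mul1r.
Qed.

Fact ga_mul1r : right_id ga_one ga_mul.
Proof.
move=> x; rewrite [x in LHS]monalgE ga_suml [RHS]monalgE.
by apply: eq_bigr => g _; rewrite ga_mulUU mulg1 mulr1.
Qed.

Fact ga_mulA : associative ga_mul.
Proof.
move=> x y z.
rewrite [x]monalgE (ga_suml _ _ (ga_mul y z)) (ga_suml _ _ y) (ga_suml _ _ z).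
apply: eq_bigr => g _; rewrite [y]monalgE (ga_suml _ _ z) !(ga_sumr _ _ (mkmalgU g _)).
rewrite (ga_suml _ _ z); apply: eq_bigr => h _.
rewrite [z]monalgE (ga_sumr _ _ (mkmalgU h _)) (ga_sumr _ _ (mkmalgU g _)).
rewrite (ga_sumr _ _ (ga_mul _ _)); apply: eq_bigr => l _.
by rewrite !ga_mulUU mulgA mulrA.
Qed.

HB.instance Definition _ := GRing.Zmodule_isPzRing.Build A
  ga_mulA ga_mul1l ga_mul1r ga_mulDl ga_mulDr.
End GroupAlgebra.

(** The quotient of a not necessarily commutative ring by the two-sided ideal
    generated by [S]. *)
Inductive gen_ideal (A : pzRingType) (S : A -> Prop) : A -> Prop :=
| gen_ideal_gen x : S x -> gen_ideal S x
| gen_ideal0 : gen_ideal S 0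
| gen_idealD x y : gen_ideal S x -> gen_ideal S y -> gen_ideal S (x + y)
| gen_idealMl a x : gen_ideal S x -> gen_ideal S (a * x)
| gen_idealMr x a : gen_ideal S x -> gen_ideal S (x * a).

Section RingQuotient.
Variables (A : pzRingType) (S : A -> Prop).

Fact gen_idealN x : gen_ideal S x -> gen_ideal S (- x).
Proof. by rewrite -mulN1r; apply: gen_idealMl. Qed.

Definition ideal_eqb (x y : A) : bool := `[< gen_ideal S (x - y) >].

Fact ideal_eqb_refl : reflexive ideal_eqb.
Proof. by move=> x; apply/asboolP; rewrite subrr; apply: gen_ideal0. Qed.
Fact ideal_eqb_sym : symmetric ideal_eqb.
Proof.
by move=> x y; apply/asboolP/asboolP => /gen_idealN; rewrite opprB.
Qed.
Fact ideal_eqb_trans : transitive ideal_eqb.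
Proof.
move=> y x z /asboolP xy /asboolP yz; apply/asboolP.
by rewrite -[x - z](subrKA y); apply: gen_idealD.
Qed.
Canonical ideal_equiv := EquivRel ideal_eqb ideal_eqb_refl ideal_eqb_sym ideal_eqb_trans.

Definition ring_quot : Type := {eq_quot ideal_eqb}.
HB.instance Definition _ := Choice.on ring_quot.
HB.instance Definition _ := EqQuotient.on ring_quot.

Definition rq_zero : ring_quot := \pi_ring_quot 0.
Definition rq_one : ring_quot := \pi_ring_quot 1.
Definition rq_opp (a : ring_quot) : ring_quot := \pi_ring_quot (- repr a).
Definition rq_add (a b : ring_quot) : ring_quot := \pi_ring_quot (repr a + repr b).
Definition rq_mul (a b : ring_quot) : ring_quot := \pi_ring_quot (repr a * repr b).

Fact pi_ideal_eq (x y : A) : gen_ideal S (x - y) -> \pi_ring_quot x = \pi y.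
Proof. by move=> xy; apply/eqmodP/asboolP. Qed.

Fact ideal_repr (x : A) : gen_ideal S (repr (\pi_ring_quot x) - x).
Proof. by apply/asboolP; have /eqmodP := reprK (\pi_ring_quot x). Qed.

Fact rq_oppE x : rq_opp (\pi x) = \pi_ring_quot (- x).
Proof. by apply: pi_ideal_eq; rewrite opprK addrC -opprB; apply/gen_idealN/ideal_repr. Qed.

Fact rq_addE x y : rq_add (\pi x) (\pi y) = \pi_ring_quot (x + y).
Proof.
apply: pi_ideal_eq; rewrite opprD addrACA.
by apply: gen_idealD; apply: ideal_repr.
Qed.

Fact rq_mulE x y : rq_mul (\pi x) (\pi y) = \pi_ring_quot (x * y).
Proof.
apply: pi_ideal_eq; set x' := repr _; set y' := repr _.
have -> : x' * y' - x * y = (x' - x) * y' + x * (y' - y).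
  by rewrite mulrBl mulrBr subrKA.
apply: gen_idealD; first by apply: gen_idealMr; apply: ideal_repr.
by apply: gen_idealMl; apply: ideal_repr.
Qed.

Let rqE := (rq_oppE, rq_addE, rq_mulE).

Fact rq_addA : associative rq_add.
Proof. by move=> a b c; rewrite -[a]reprK -[b]reprK -[c]reprK !rqE addrA. Qed.
Fact rq_addC : commutative rq_add.
Proof. by move=> a b; rewrite -[a]reprK -[b]reprK !rqE addrC. Qed.
Fact rq_add0 : left_id rq_zero rq_add.
Proof. by move=> a; rewrite -[a]reprK !rqE add0r. Qed.
Fact rq_addN : left_inverse rq_zero rq_opp rq_add.
Proof. by move=> a; rewrite -[a]reprK !rqE addNr. Qed.
Fact rq_mulA : associative rq_mul.
Proof. by move=> a b c; rewrite -[a]reprK -[b]reprK -[c]reprK !rqE mulrA. Qed.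
Fact rq_mul1l : left_id rq_one rq_mul.
Proof. by move=> a; rewrite -[a]reprK !rqE mul1r. Qed.
Fact rq_mul1r : right_id rq_one rq_mul.
Proof. by move=> a; rewrite -[a]reprK !rqE mulr1. Qed.
Fact rq_mulDl : left_distributive rq_mul rq_add.
Proof. by move=> a b c; rewrite -[a]reprK -[b]reprK -[c]reprK !rqE mulrDl. Qed.
Fact rq_mulDr : right_distributive rq_mul rq_add.
Proof. by move=> a b c; rewrite -[a]reprK -[b]reprK -[c]reprK !rqE mulrDr. Qed.

HB.instance Definition _ := GRing.isPzRing.Build ring_quot
  rq_addA rq_addC rq_add0 rq_addN rq_mulA rq_mul1l rq_mul1r rq_mulDl rq_mulDr.
End RingQuotient.

(** [rd_char] is [X^*], [rd_cochar] is [X_*]. The finite set [R] is indexed by the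
    finite type [rd_roots]; injectivity of [rd_root] and [rd_coroot] encodes the
    bijection between [R] and [R^vee]. The Z-basis [cobasis] of [X_*], with
    coordinate map [cocoord], witnesses that [X_*] is free of finite rank; it
    is used only to write [X_* (x) R] as [R^rd_rank]. *)
Record root_datum := RootDatum {
  rd_char : zmodType;
  rd_cochar : zmodType;
  rd_pairing : rd_char -> rd_cochar -> int;
  pairingDl : forall y, {morph rd_pairing^~ y : a b / a + b};
  pairingDr : forall a, {morph rd_pairing a : y z / y + z};
  pairing_perfectl : forall f : {additive rd_cochar -> int},
    exists! a : rd_char, forall y, rd_pairing a y = f y;
  pairing_perfectr : forall f : {additive rd_char -> int},
    exists! y : rd_cochar, forall a, rd_pairing a y = f a;
  rd_rank : nat;
  cobasis : 'I_rd_rank -> rd_cochar;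
  cocoord : rd_cochar -> 'rV[int]_rd_rank;
  cocoordK : forall y, \sum_i cobasis i *~ cocoord y 0 i = y;
  cobasisK : forall c : 'rV[int]_rd_rank, cocoord (\sum_i cobasis i *~ c 0 i) = c;
  rd_roots : finType;
  rd_root : rd_roots -> rd_char;
  rd_coroot : rd_roots -> rd_cochar;
  root_inj : injective rd_root;
  coroot_inj : injective rd_coroot;
  pairing_coroot : forall a, rd_pairing (rd_root a) (rd_coroot a) = 2;
  refl_root : forall a b, exists c,
    rd_root c = rd_root b - rd_root a *~ rd_pairing (rd_root b) (rd_coroot a);
  refl_coroot : forall a b, exists c,
    rd_coroot c = rd_coroot b - rd_coroot a *~ rd_pairing (rd_root a) (rd_coroot b);
  rd_ssrank : nat;
  rd_simple : 'I_rd_ssrank -> rd_roots;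
  simple_free : forall c : 'I_rd_ssrank -> int,
    \sum_i rd_root (rd_simple i) *~ c i = 0 -> forall i, c i = 0;
  simple_span : forall a, exists c : 'I_rd_ssrank -> nat,
    rd_root a = \sum_i rd_root (rd_simple i) *+ c i \/
    rd_root a = - \sum_i rd_root (rd_simple i) *+ c i
}.

Section RootDatum.
Variable D : root_datum.
Implicit Types (a b : rd_roots D) (y z : rd_cochar D).
Local Notation "<< a , y >>" := (@rd_pairing D (rd_root a) y).

Definition rd_reduced : Prop := forall a b (m p : int),
  m != 0 -> rd_root a *~ m = rd_root b *~ p -> rd_root b = rd_root a \/ rd_root b = - rd_root a.

Definition rd_irreducible : Prop :=
  (exists a : rd_roots D, True) /\
  forall P : pred (rd_roots D),
    (forall a b, P a -> ~~ P b -> << a, rd_coroot b >> = 0) ->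
    (forall a, P a) \/ (forall a, ~~ P a).

Definition rd_positive a : bool :=
  `[< exists c : 'I_(rd_ssrank D) -> nat, rd_root a = \sum_i rd_root (rd_simple i) *+ c i >].
Definition rd_negative a : bool :=
  `[< exists c : 'I_(rd_ssrank D) -> nat, rd_root a = - \sum_i rd_root (rd_simple i) *+ c i >].

Definition is_highest_root a : Prop := forall b,
  exists c : 'I_(rd_ssrank D) -> nat, rd_root a - rd_root b = \sum_i rd_root (rd_simple i) *+ c i.

Definition refl_fun a y : rd_cochar D := y - rd_coroot a *~ << a, y >>.

Fact pairing_additive (c : rd_char D) : additive (rd_pairing c).
Proof.
have h0 : rd_pairing c (0 : rd_cochar D) = 0.
  by apply: (addrI (rd_pairing c 0)); rewrite -pairingDr !addr0.
move=> y z; rewrite pairingDr; congr (_ + _).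
by apply: (addrI (rd_pairing c z)); rewrite -pairingDr !subrr.
Qed.
HB.instance Definition _ (c : rd_char D) :=
  GRing.isZmodMorphism.Build (rd_cochar D) int (rd_pairing c) (pairing_additive c).

Fact refl_funK a : involutive (refl_fun a).
Proof.
move=> y; rewrite /refl_fun raddfB raddfMz /= pairing_coroot mulrzz.
rewrite -addrA -opprD -mulrzDr.
suff -> t : t + (t - 2 * t) = 0 :> int by rewrite mulr0z subr0.
by rewrite mulr_natl mulr2n addrA subrr.
Qed.

Definition rd_refl a : symg (rd_cochar D) := Symg (refl_funK a) (refl_funK a).

Definition rd_weyl : symg (rd_cochar D) -> Prop :=
  gen_subgroup (fun s => exists a, s = rd_refl a).

Fact weyl_additive (w : symg (rd_cochar D)) : rd_weyl w -> {morph w : y z / y + z}.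
Proof.
elim=> {w} [_ [a ->] y z|y z|u v _ IHu _ IHv y z|w _ IHw y z] //=.
- by rewrite /refl_fun pairingDr mulrzDr opprD addrACA.
- by rewrite IHv IHu.
- by apply: (can_inj (@symg_funK _ w)); rewrite IHw !symg_invK.
Qed.

(** The root [b] is [w(a)], for the action of [w] on [X^*] contragredient to
    that on [X_*]. *)
Definition maps_root (w : symg (rd_cochar D)) a b : Prop :=
  forall y, << b, w y >> = << a, y >>.
Definition maps_pos (w : symg (rd_cochar D)) a : bool :=
  [exists b, rd_positive b && `[< maps_root w a b >]].
Definition maps_neg (w : symg (rd_cochar D)) a : bool :=
  [exists b, rd_negative b && `[< maps_root w a b >]].

(** The element [eps^ew_tr * ew_lin] of the semidirect product of [X_*]
    and [W]. *)
Record ext_weyl := ExtWeyl {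
  ew_tr : rd_cochar D;
  ew_lin : symg (rd_cochar D);
  ew_linP : rd_weyl ew_lin
}.

HB.instance Definition _ := gen_eqMixin ext_weyl.
HB.instance Definition _ := gen_choiceMixin ext_weyl.

Fact ext_weyl_eqP (x y : ext_weyl) :
  ew_tr x = ew_tr y -> ew_lin x = ew_lin y -> x = y.
Proof.
case: x y => [t w wP] [t' w' w'P] /= tt' ww'; subst.
by congr ExtWeyl; apply: Prop_irrelevance.
Qed.

Definition ew_one : ext_weyl := ExtWeyl 0 (gen_subgroup_one _).
Definition ew_mul (x y : ext_weyl) : ext_weyl :=
  ExtWeyl (ew_tr x + ew_lin x (ew_tr y))
          (gen_subgroup_mul (ew_linP x) (ew_linP y)).
Definition ew_inv (x : ext_weyl) : ext_weyl :=
  ExtWeyl (- symg_inv (ew_lin x) (ew_tr x)) (gen_subgroup_inv (ew_linP x)).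

Fact weyl0 w : rd_weyl w -> w 0 = 0.
Proof.
by move=> /weyl_additive wD; apply: (addrI (w 0)); rewrite -wD !addr0.
Qed.
Fact weylN w y : rd_weyl w -> w (- y) = - w y.
Proof.
move=> wP; apply: (addrI (w y)).
by rewrite -(weyl_additive wP) !subrr weyl0.
Qed.

Fact ew_mulA : associative ew_mul.
Proof.
move=> x y z; apply: ext_weyl_eqP; last exact: mulgA.
by rewrite /= (weyl_additive (ew_linP x)) addrA.
Qed.
Fact ew_mul1 : left_id ew_one ew_mul.
Proof. by move=> x; apply: ext_weyl_eqP => /=; [rewrite add0r|exact: mul1g]. Qed.
Fact ew_1mul : right_id ew_one ew_mul.
Proof.
move=> x; apply: ext_weyl_eqP => /=; last exact: mulg1.
by rewrite (weyl0 (ew_linP x)) addr0.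
Qed.
Fact ew_mulV : left_inverse ew_one ew_inv ew_mul.
Proof. by move=> x; apply: ext_weyl_eqP => /=; [rewrite addNr|exact: mulVg]. Qed.
Fact ew_Vmul : right_inverse ew_one ew_inv ew_mul.
Proof.
move=> x; apply: ext_weyl_eqP => /=; last exact: mulgV.
by rewrite (weylN _ (ew_linP x)) symg_invK subrr.
Qed.
HB.instance Definition _ :=
  isGroup.Build ext_weyl ew_mulA ew_mul1 ew_1mul ew_mulV ew_Vmul.

Definition translation y : ext_weyl := ExtWeyl y (gen_subgroup_one _).
Definition finite_refl a : ext_weyl :=
  ExtWeyl 0 (gen_subgroup_gen (ex_intro _ a erefl)).

(** [eps^mu w = w eps^lam] with [lam = w^-1 mu]. *)
Definition ew_length (x : ext_weyl) : nat :=
  let w := ew_lin x in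
  let lam := symg_inv w (ew_tr x) in
  (\sum_(a : rd_roots D | rd_positive a && maps_neg w a) absz (<< a, lam >> + 1)%R +
   \sum_(a : rd_roots D | rd_positive a && maps_pos w a) absz << a, lam >>)%N.

(** [theta] is meant to be the highest root: index [0] gives
    [s_0 = eps^(theta^vee) s_theta], index [i.+1] the [i]-th simple reflection. *)
Definition affine_refl (theta : rd_roots D) (i : 'I_(rd_ssrank D).+1) : ext_weyl :=
  if unlift ord0 i is Some j then finite_refl (rd_simple j)
  else (translation (rd_coroot theta) * finite_refl theta)%g.

Definition affine_weyl (theta : rd_roots D) : ext_weyl -> Prop :=
  gen_subgroup (fun s => exists i, s = affine_refl theta i).

Definition word_prod (theta : rd_roots D) (s : seq 'I_(rd_ssrank D).+1) : ext_weyl :=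
  (\prod_(i <- s) affine_refl theta i)%g.

Definition braid_rel (u v : seq (ext_weyl * bool)) : Prop :=
  exists x y : ext_weyl, [/\ ew_length (x * y)%g = (ew_length x + ew_length y)%N,
    u = [:: (x, true); (y, true)] & v = [:: ((x * y)%g, true)]].

Definition braid_group : Type := pres_group braid_rel.
HB.instance Definition _ := Group.on braid_group.

Definition braidT (x : ext_weyl) : braid_group := pres_gen braid_rel x.

Section Hecke.
Variables (theta : rd_roots D) (k : comPzRingType) (q : k).
Local Notation kB := (group_alg k braid_group).

Definition hecke_rel (z : kB) : Prop := exists i : 'I_(rd_ssrank D).+1,
  let T : kB := ga_basis (braidT (affine_refl theta i)) 1 in
  z = (T + 1) * (T - ga_basis 1%g q).

Definition hecke : Type := ring_quot hecke_rel.
HB.instance Definition _ := GRing.PzRing.on hecke.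

Definition of_braid (g : braid_group) : hecke := \pi_(ring_quot hecke_rel) (ga_basis g 1 : kB).

(** [T_x] if [e] is [true], [T_x^-1] if [e] is [false]. *)
Definition heckeT (x : ext_weyl) (e : bool) : hecke :=
  of_braid (if e then braidT x else (braidT x)^-1)%g.

Fact of_braidM g h : of_braid (g * h)%g = of_braid g * of_braid h.
Proof.
have e : (ga_basis (g * h)%g 1 : kB) = ga_basis g 1 * ga_basis h 1.
  by rewrite -[RHS]/(ga_mul _ _) ga_mulUU mulr1.
by rewrite /of_braid e -[RHS]/(rq_mul _ _) rq_mulE.
Qed.
Fact of_braid1 : of_braid 1%g = 1. Proof. by []. Qed.
Fact heckeTV x e : heckeT x e * heckeT x (~~ e) = 1.
Proof. by case: e; rewrite -of_braidM ?mulgV ?mulVg of_braid1. Qed.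
End Hecke.

Section Alcoves.
Variable R : realType.
Local Notation V := 'rV[R]_(rd_rank D).

Definition real_pairing (c : rd_char D) (p : V) : R :=
  \sum_i p 0 i * (rd_pairing c (cobasis i))%:~R.

Definition real_cochar (y : rd_cochar D) : V := map_mx intr (cocoord y).

(** The [R]-linear extension of an additive map. *)
Definition real_ext (f : rd_cochar D -> rd_cochar D) (p : V) : V :=
  \sum_i p 0 i *: real_cochar (f (cobasis i)).

Definition act (x : ext_weyl) (p : V) : V :=
  real_cochar (ew_tr x) + real_ext (ew_lin x) p.

Definition hyperplane a (j : int) : set V := [set p | real_pairing (rd_root a) p = j%:~R].
Definition below a (j : int) : set V := [set p | real_pairing (rd_root a) p < j%:~R].
Definition above a (j : int) : set V := [set p | real_pairing (rd_root a) p > j%:~R].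

Definition hyperplanes : set V := [set p | exists a j, hyperplane a j p].
Definition dominant_chamber : set V :=
  [set p | forall i, 0 < real_pairing (rd_root (rd_simple i)) p].

Definition alcove (A : set V) : Prop :=
  exists2 p, (~` hyperplanes) p & A = connected_component (~` hyperplanes) p.

Definition is_base_alcove (A : set V) : Prop :=
  [/\ alcove A, A `<=` dominant_chamber & closure A 0].

Definition same_side a j (A B : set V) : Prop :=
  (A `<=` below a j /\ B `<=` below a j) \/ (A `<=` above a j /\ B `<=` above a j).

Section Walk.
Variables (theta : rd_roots D) (A0 : set V).

(** The (closed) face of type [i] of [x A0], where [A0] is the base alcove. *)
Definition face (x : ext_weyl) (i : 'I_(rd_ssrank D).+1) : set V :=
  act x @` (closure A0 `&` [set p | act (affine_refl theta i) p = p]).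

(** [H_{a,j}], with [a] positive, is the affine root hyperplane containing the
    face of type [i] of [x A0]. *)
Definition is_wall x i a j : Prop := rd_positive a /\ face x i `<=` hyperplane a j.

Definition same_side_wall x i (B : set V) : bool :=
  `[< exists a j, is_wall x i a j /\ same_side a j (act x @` A0) B >].

Variables (n : nat) (s : n.-tuple 'I_(rd_ssrank D).+1) (B : set V).

Definition walk_prefix (nu : 'I_n) : ext_weyl := word_prod theta (take nu s).

Definition far_antidominant : Prop := forall (nu : 'I_n) a j,
  is_wall (walk_prefix nu) (tnth s nu) a j -> B `<=` below a j.

Definition Psi (k : comPzRingType) (q : k) : hecke theta q :=
  \prod_(nu < n) heckeT theta q (affine_refl theta (tnth s nu))
                   (same_side_wall (walk_prefix nu) (tnth s nu) B).
End Walk.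
End Alcoves.
End RootDatum.

(* Main.v *)
(** For [lam] in [X_*] far enough in the dominant chamber, [T_(eps^lam) * Psi(w) =
    T_(eps^lam w)]; since [T_(eps^lam)] is invertible and [lam] can be chosen for
    two expressions of [w] at once, [Psi(w)] depends on [w] only. Let [x] be the
    product of the letters preceding [s_i] in the expression, and let [beta_i] be
    the gradient of the affine root that vanishes on the face of type [i] of the
    base alcove: a simple root, or minus the highest root. The sign attached to
    this letter is [1] exactly when the linear part of [x] sends [beta_i] to a
    negative root. On the other hand [ell(eps^mu u) = <2 rho, mu> - ell(u)] when
    [mu] is dominant and regular, and this formula shows that right multiplication
    of [eps^lam x] by [s_i] increases the length by [1] in that case, and decreases
    it by [1] otherwise. So each letter turns [T_(eps^lam x)] into
    [T_(eps^lam x s_i)]. *)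
From HB Require Import structures.
Require Import Defs.
From mathcomp Require Import all_boot all_order all_algebra.
From mathcomp Require Import all_classical all_reals topology normedtype.
From mathcomp Require Import zify ring lra.

Set Implicit Arguments.
Unset Strict Implicit.
Unset Printing Implicit Defensive.

Import Order.TTheory GRing.Theory Num.Theory.
Import numFieldNormedType.Exports.

Local Open Scope ring_scope.

(** * Roots *)

Section Roots.
Variable D : root_datum.
Implicit Types (a b c : rd_roots D) (y : rd_cochar D) (w u : symg (rd_cochar D)).
Local Notation "<< a , y >>" := (@rd_pairing D (rd_root a) y).
Local Notation simple_root i := (rd_root (@rd_simple D i)).

(** This is the uniqueness half of [pairing_perfectl], for the functional defined by [x']. *)
Lemma char_eqP (x x' : rd_char D) :
  (forall y, rd_pairing x y = rd_pairing x' y) -> x = x'.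
Proof.
move=> xx'; have [z [_ zP]] := @pairing_perfectl D (@rd_pairing D x').
by rewrite -(zP x' (fun=> erefl)) -(zP x xx').
Qed.

Lemma pairing0l y : rd_pairing (0 : rd_char D) y = 0.
Proof. by apply: (addrI (rd_pairing 0 y)); rewrite -pairingDl !addr0. Qed.

Lemma pairingNl (x : rd_char D) y : rd_pairing (- x) y = - rd_pairing x y.
Proof. by apply: (addrI (rd_pairing x y)); rewrite -pairingDl !subrr pairing0l. Qed.

Lemma pairingMzl (x : rd_char D) (n : int) y :
  rd_pairing (x *~ n) y = rd_pairing x y * n.
Proof.
have pos (m : nat) : rd_pairing (x *+ m) y = rd_pairing x y * m%:Z.
  elim: m => [|m IHm]; first by rewrite pairing0l mulr0.
  by rewrite mulrS pairingDl IHm intS mulrDr mulr1.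
by case: n => n; rewrite ?NegzE ?mulrNz ?pairingNl -?pmulrn pos ?mulrN.
Qed.

Lemma pairing_suml (I : finType) (f : I -> rd_char D) y :
  rd_pairing (\sum_i f i) y = \sum_i rd_pairing (f i) y.
Proof.
by elim/big_rec2: _ => [|i x z _ <-]; rewrite ?pairing0l // pairingDl.
Qed.

(** Existence is turned into a sigma type by [cid], so that the coordinates become a function
    [root_coef]; by [coef_eq] they do not depend on this choice. *)
Lemma root_coefP a : { c : 'I_(rd_ssrank D) -> int |
  rd_root a = \sum_i simple_root i *~ c i /\
  ((forall i, 0 <= c i) \/ (forall i, c i <= 0)) }.
Proof.
apply: cid; have [c [ac|ac]] := simple_span a.
  exists (fun i => (c i)%:Z); split; last by left.
  by rewrite ac; apply: eq_bigr => i _; rewrite pmulrn.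
exists (fun i => - (c i)%:Z); split; last by right=> i; rewrite oppr_le0.
by rewrite ac -sumrN; apply: eq_bigr => i _; rewrite mulrNz pmulrn.
Qed.

Definition root_coef a : 'I_(rd_ssrank D) -> int := sval (root_coefP a).

Lemma root_coefE a : rd_root a = \sum_i simple_root i *~ root_coef a i.
Proof. by case: (svalP (root_coefP a)). Qed.

Lemma coef_eq (c c' : 'I_(rd_ssrank D) -> int) :
  \sum_i simple_root i *~ c i = \sum_i simple_root i *~ c' i -> c =1 c'.
Proof.
move=> cc' i; apply/eqP; rewrite -subr_eq0; apply/eqP.
apply: (simple_free (c := fun i => c i - c' i)).
rewrite -[RHS](subrr (\sum_i simple_root i *~ c' i)) -{1}cc' -sumrB.
by apply: eq_bigr => j _; rewrite mulrzBr.
Qed.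

Lemma root_coef_comb a b c (m n : int) :
  rd_root c = rd_root a *~ m + rd_root b *~ n ->
  forall i, root_coef c i = root_coef a i * m + root_coef b i * n.
Proof.
rewrite !root_coefE => e; apply: coef_eq; rewrite e !mulrz_suml -big_split /=.
by apply: eq_bigr => i _; rewrite mulrzDr !mulrzA.
Qed.

Lemma root_neq0 a : rd_root a != 0.
Proof. by apply/eqP => a0; have := pairing_coroot a; rewrite a0 pairing0l. Qed.

Lemma root_coef_neq0 a : exists i, root_coef a i != 0.
Proof.
apply: contrapT => /forallNP a0; have /eqP := root_neq0 a; apply.
rewrite root_coefE big1 // => i _.
by have /negP := a0 i; rewrite negbK => /eqP ->.
Qed.

Lemma positive_coef a : rd_positive a = `[< forall i, 0 <= root_coef a i >].
Proof.
apply/asboolP/asboolP => [[c ac] i|a0].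
  suff -> : root_coef a i = (c i)%:Z by [].
  apply: (coef_eq (c' := fun i => (c i)%:Z)); rewrite -root_coefE ac.
  by apply: eq_bigr => j _; rewrite pmulrn.
exists (fun i => absz (root_coef a i)); rewrite {1}root_coefE.
by apply: eq_bigr => i _; rewrite pmulrn gez0_abs.
Qed.

Lemma positive_coef_ge0 a : rd_positive a -> forall i, 0 <= root_coef a i.
Proof. by rewrite positive_coef => /asboolP. Qed.

Lemma negative_coef_le0 a : ~~ rd_positive a -> forall i, root_coef a i <= 0.
Proof.
rewrite positive_coef => /asboolP na.
by case: (svalP (root_coefP a)) => _ [].
Qed.

(** All coordinates of a root have the same sign, so a single one decides. *)
Lemma positive_gt0 a i : 0 < root_coef a i -> rd_positive a.
Proof. by move=> a0; apply/negPn/negP => /negative_coef_le0/(_ i); lia. Qed.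

Lemma positive_coef_gt0 a : rd_positive a -> exists i, 0 < root_coef a i.
Proof.
move=> ap; have [i ai] := root_coef_neq0 a; exists i.
by rewrite lt_def ai positive_coef_ge0.
Qed.

Lemma negative_positiveN a : rd_negative a = ~~ rd_positive a.
Proof.
apply/idP/idP => [/asboolP[c ac]|na].
  apply/negP => /positive_coef_gt0[i]; suff -> : root_coef a i = - (c i)%:Z by lia.
  apply: (coef_eq (c' := fun i => - (c i)%:Z)); rewrite -root_coefE ac -sumrN.
  by apply: eq_bigr => j _; rewrite mulrNz pmulrn.
apply/asboolP; exists (fun i => absz (root_coef a i)); rewrite {1}root_coefE -sumrN.
apply: eq_bigr => i _; rewrite pmulrn lez0_abs ?negative_coef_le0 //.
by rewrite mulrNz opprK.
Qed.

Lemma root_coef_simple i j : root_coef (@rd_simple D i) j = (i == j)%:Z.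
Proof.
apply: (coef_eq (c' := fun j => (i == j)%:Z)); rewrite -root_coefE.
rewrite (bigD1 i) //= eqxx big1 ?addr0 // => k /negPf.
by rewrite eq_sym => ->.
Qed.

Lemma simple_positive i : rd_positive (@rd_simple D i).
Proof. by apply: (@positive_gt0 _ i); rewrite root_coef_simple eqxx. Qed.

(** The default [a] is never returned for [w] in the Weyl group, by [maps_root_ex]. *)
Definition root_act w a : rd_roots D := odflt a [pick b | `[< maps_root w a b >]].

Lemma maps_root_refl a b c :
  maps_root (rd_refl a) b c <-> rd_root c = rd_root b - rd_root a *~ << b, rd_coroot a >>.
Proof.
have pair y : rd_pairing (rd_root b - rd_root a *~ << b, rd_coroot a >>) y =
    << b, rd_refl a y >>.
  rewrite pairingDl pairingNl pairingMzl /= /refl_fun raddfB raddfMz /=.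
  by rewrite -mulrzr intz mulrC.
split=> [bc|cE y]; last by rewrite cE pair /= refl_funK.
by apply: char_eqP => y; rewrite pair -bc /= refl_funK.
Qed.

Lemma maps_root_ex a w : rd_weyl w -> exists b, maps_root w a b.
Proof.
move=> wP; elim: wP a => {w} [_ [b ->] a||u v _ IHu _ IHv a|u uP IHu a].
- by have [c cE] := refl_root b a; exists c; apply/maps_root_refl.
- by move=> a; exists a.
- have [b ab] := IHv a; have [c bc] := IHu b; exists c => y /=.
  by rewrite bc ab.
(* For an inverse: [u] acts injectively on the finite set of roots, hence bijectively, and the
   inverse permutation gives the image. *)
- pose f b : rd_roots D := sval (cid (IHu b)).
  have fP b : maps_root u b (f b) by apply: svalP.
  have finj : injective f.
    move=> b b' ff; apply/root_inj/char_eqP => y.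
    by rewrite -(fP b) ff (fP b').
  have [g _ gK] := injF_bij finj; exists (g a) => y.
  by rewrite -(fP (g a)) gK /= symg_invK.
Qed.

Lemma root_actP w a : rd_weyl w -> maps_root w a (root_act w a).
Proof.
move=> /(maps_root_ex a)[b ab]; rewrite /root_act.
by case: pickP => [c /asboolP //|/(_ b)/asboolP].
Qed.

Lemma root_actE w a b : rd_weyl w -> maps_root w a b -> root_act w a = b.
Proof.
move=> wP ab; apply/root_inj/char_eqP => y.
by rewrite -(symg_invK w y) (root_actP a wP) ab.
Qed.

Lemma root_act_inj w : rd_weyl w -> injective (root_act w).
Proof.
move=> wP b b' e; apply/root_inj/char_eqP => y.
by rewrite -(root_actP b wP) e (root_actP b' wP).
Qed.

Lemma root_act1 a : root_act 1%g a = a.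
Proof. exact: root_actE (gen_subgroup_one _) _. Qed.

Lemma root_actM w u a : rd_weyl w -> rd_weyl u ->
  root_act (w * u)%g a = root_act w (root_act u a).
Proof.
move=> wP uP; apply: root_actE; first exact: gen_subgroup_mul.
by move=> y /=; rewrite (root_actP _ wP) (root_actP _ uP).
Qed.

Lemma refl_weyl a : rd_weyl (rd_refl a).
Proof. by apply: gen_subgroup_gen; exists a. Qed.

Lemma root_act_refl a b : rd_root (root_act (rd_refl a) b) =
  rd_root b - rd_root a *~ << b, rd_coroot a >>.
Proof. exact/maps_root_refl/root_actP/refl_weyl. Qed.

Lemma root_act_reflK a : involutive (root_act (rd_refl a)).
Proof.
move=> b; rewrite -root_actM; [|exact: refl_weyl..].
suff -> : (rd_refl a * rd_refl a)%g = 1%g by rewrite root_act1.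
by apply: symg_eqP => y /=; rewrite refl_funK.
Qed.

Lemma root_coef_refl a b i : root_coef (root_act (rd_refl a) b) i =
  root_coef b i - root_coef a i * << b, rd_coroot a >>.
Proof.
rewrite (@root_coef_comb b a _ 1 (- << b, rd_coroot a >>)) ?mulr1 ?mulrN //.
by rewrite root_act_refl mulr1z mulrNz.
Qed.

(** The root [-a] is obtained as [s_a(a)], so that it comes with an index in [rd_roots]. *)
Definition neg_root a := root_act (rd_refl a) a.

Lemma neg_rootE a : rd_root (neg_root a) = - rd_root a.
Proof. by rewrite root_act_refl pairing_coroot mulrz_nat mulr2n opprD addNKr. Qed.

Lemma neg_rootK : involutive neg_root.
Proof. by move=> a; apply: root_inj; rewrite !neg_rootE opprK. Qed.

Lemma pairing_neg_root a y : << neg_root a, y >> = - << a, y >>.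
Proof. by rewrite neg_rootE pairingNl. Qed.

Lemma root_coef_neg a i : root_coef (neg_root a) i = - root_coef a i.
Proof. by rewrite root_coef_refl pairing_coroot; lia. Qed.

Lemma positive_neg_root a : rd_positive (neg_root a) = ~~ rd_positive a.
Proof.
apply/idP/idP => [/positive_coef_gt0[i] na|].
  by apply/negP => /positive_coef_ge0/(_ i); rewrite root_coef_neg in na *; lia.
move=> na; have [i ai] := root_coef_neq0 a; apply: (@positive_gt0 _ i).
by rewrite root_coef_neg; have := negative_coef_le0 na i; lia.
Qed.

Lemma root_act_neg w a : rd_weyl w -> root_act w (neg_root a) = neg_root (root_act w a).
Proof.
by move=> wP; apply: root_actE => // y; rewrite !pairing_neg_root root_actP.
Qed.

Definition root_sign a : int := if rd_positive a then 1 else -1.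

Lemma root_sign_neg a : root_sign (neg_root a) = - root_sign a.
Proof. by rewrite /root_sign positive_neg_root; case: rd_positive. Qed.

(** The negative roots are the opposites of the positive ones, and [f] takes the same values on
    them. *)
Lemma sum_even_root (f : rd_roots D -> int) :
  (forall a, f (neg_root a) = f a) ->
  \sum_a f a = 2 * \sum_(a | rd_positive a) f a.
Proof.
move=> fN; rewrite (bigID (@rd_positive D)) /= mulr_natl mulr2n; congr (_ + _).
rewrite (reindex_inj (can_inj neg_rootK)) /=.
by apply: eq_big => [a|a _]; rewrite ?positive_neg_root ?negbK ?fN.
Qed.

(** Both sides are half of the sum over all roots. *)
Lemma sum_even_root_act w (f : rd_roots D -> int) : rd_weyl w ->
  (forall a, f (neg_root a) = f a) ->
  \sum_(a | rd_positive a) f (root_act w a) = \sum_(a | rd_positive a) f a.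
Proof.
move=> wP fN; apply: (@mulfI _ (2 : int)) => //; rewrite -!sum_even_root //.
  by rewrite [RHS](reindex_inj (root_act_inj wP)).
by move=> a; rewrite root_act_neg.
Qed.

End Roots.

(** * Lengths in the extended affine Weyl group *)

(** In the application, [g j] is the Hecke element reached after [j] letters. *)
Lemma prod_telescope (A : pzRingType) n (f : 'I_n -> A) (g : nat -> A) :
  (forall j : 'I_n, g j * f j = g j.+1) -> g 0 * \prod_(i < n) f i = g n.
Proof.
elim: n f => [|n IHn] f fg; first by rewrite big_ord0 mulr1.
rewrite big_ord_recr mulrA IHn => [|j]; first exact: (fg ord_max).
exact: (fg (widen_ord (leqnSn n) j)).
Qed.

Section AffineLength.
Variables (D : root_datum) (D_reduced : rd_reduced D).
Variables (theta : rd_roots D) (theta_highest : is_highest_root theta).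
Implicit Types (a b : rd_roots D) (y : rd_cochar D) (i : 'I_(rd_ssrank D).+1)
  (x : ext_weyl D).
Local Notation "<< a , y >>" := (@rd_pairing D (rd_root a) y).

Lemma root_coef_highest a j : root_coef a j <= root_coef theta j.
Proof.
have [c ac] := theta_highest a; rewrite -subr_ge0.
suff -> : root_coef theta j - root_coef a j = (c j)%:Z by [].
apply: (coef_eq (c := fun j => root_coef theta j - root_coef a j) (c' := fun j => (c j)%:Z)).
under eq_bigr do rewrite mulrzBr.
by rewrite sumrB -!root_coefE ac; apply: eq_bigr => l _; rewrite pmulrn.
Qed.

Lemma root_coef_highest_gt0 j : 0 < root_coef theta j.
Proof. by have := root_coef_highest (rd_simple j) j; rewrite root_coef_simple eqxx; lia. Qed.

Lemma highest_positive : rd_positive theta.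
Proof.
have [j _] := root_coef_neq0 theta.
exact: positive_gt0 (root_coef_highest_gt0 j).
Qed.

(** The reflection changes only the coordinate at [j], and in a reduced system a positive root other
    than the simple root has a positive coordinate elsewhere, which survives. *)
Lemma simple_refl_positive j a : rd_positive a -> a != rd_simple j ->
  rd_positive (root_act (rd_refl (rd_simple j)) a).
Proof.
move=> ap aj; suff [l lj al] : exists2 l, l != j & 0 < root_coef a l.
  apply: (@positive_gt0 _ _ l).
  by rewrite root_coef_refl root_coef_simple eq_sym (negPf lj) mul0r subr0.
apply: contrapT => al0; have aE : rd_root a = rd_root (rd_simple j) *~ root_coef a j.
  rewrite {1}root_coefE (bigD1 j) //= big1 ?addr0 // => l lj.
  suff -> : root_coef a l = 0 by [].
  apply/eqP; rewrite eq_le positive_coef_ge0 // andbT leNgt.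
  by apply/negP => al; apply: al0; exists l.
have [] := @D_reduced a (rd_simple j) 1 (root_coef a j) _ aE; first by [].
  by move=> /root_inj e; rewrite e eqxx in aj.
rewrite -neg_rootE => /root_inj e.
by have := positive_neg_root a; rewrite -e simple_positive ap.
Qed.

(** The coordinates of [theta] dominate those of every root. For [s_theta(a)] this excludes [m < 0],
    and for its opposite it excludes [m > 1] unless [a = theta]. If [m = 0] the reflection fixes
    [a]; if [m = 1] it gives [a - theta], which is negative. *)
Lemma highest_pairing a : rd_positive a -> a != theta ->
  << a, rd_coroot theta >> = (~~ rd_positive (root_act (rd_refl theta) a))%:Z.
Proof.
move=> ap at_; set m := << _, _ >>.
have sE l : root_coef (root_act (rd_refl theta) a) l = root_coef a l - root_coef theta l * m.
  by rewrite root_coef_refl.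
have [l al] := positive_coef_gt0 ap; have tl := root_coef_highest a l.
have m_ge0 : 0 <= m.
  rewrite leNgt; apply/negP => m0.
  have := root_coef_highest (root_act (rd_refl theta) a) l.
  rewrite sE; nia.
have m_le1 : m <= 1.
  rewrite leNgt; apply/negP => m1.
  have nE l' : - root_coef a l' + root_coef theta l' * m <= root_coef theta l'.
    have := root_coef_highest (neg_root (root_act (rd_refl theta) a)) l'.
    by rewrite root_coef_neg sE; lia.
  case/eqP: at_; apply/root_inj; rewrite root_coefE [RHS]root_coefE.
  apply: eq_bigr => l' _; congr (_ *~ _).
  have := nE l'; have := root_coef_highest a l'; have := root_coef_highest_gt0 l'; nia.
have [m0|m1] : m = 0 \/ m = 1 by lia.
  rewrite m0 (@positive_gt0 _ _ l) //.
  by rewrite sE m0; lia.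
rewrite m1; case: (boolP (rd_positive _)) => // /positive_coef_ge0 sp.
case/eqP: at_; apply/root_inj; rewrite root_coefE [RHS]root_coefE.
apply: eq_bigr => l' _; congr (_ *~ _).
by have := sp l'; have := root_coef_highest a l'; rewrite sE m1; lia.
Qed.

(** The gradient of the affine root, positive on the base alcove, that vanishes
    on the face of type [i]; its constant term is [affine_const i]. *)
Definition affine_root i : rd_roots D :=
  if unlift ord0 i is Some j then rd_simple j else neg_root theta.
Definition affine_const i : int := if unlift ord0 i is Some _ then 0 else 1.

Lemma affine_refl_lin i :
  ew_lin (affine_refl theta i) = rd_refl (if unlift ord0 i is Some j then rd_simple j else theta).
Proof.
by rewrite /affine_refl; case: unlift => //=; apply: mul1g.
Qed.

Lemma affine_refl_tr i :
  ew_tr (affine_refl theta i) = rd_coroot theta *~ affine_const i.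
Proof.
by rewrite /affine_refl /affine_const; case: unlift => [j|] /=; rewrite ?mulr0z ?mulr1z ?addr0.
Qed.

Lemma root_act_affine_root i :
  root_act (ew_lin (affine_refl theta i)) (affine_root i) = neg_root (affine_root i).
Proof.
rewrite affine_refl_lin /affine_root; case: unlift => [j|] //.
by rewrite root_act_neg //; apply: refl_weyl.
Qed.

(** In the affine sense, [s_i] changes the sign of no positive root other than
    [affine_root i] up to sign. *)
Lemma affine_refl_defect i a : rd_positive a ->
  << a, ew_tr (affine_refl theta i) >>
    - (~~ rd_positive (root_act (ew_lin (affine_refl theta i)) a))%:Z =
  - root_sign (affine_root i) *
    (a == if rd_positive (affine_root i) then affine_root i else neg_root (affine_root i))%:Z.
Proof.
move=> ap; rewrite affine_refl_lin affine_refl_tr /affine_root /affine_const.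
rewrite /root_sign; case: unlift => [j|].
  rewrite mulr0z raddf0 simple_positive; have [->|aj] := eqVneq a (rd_simple j).
    by rewrite -/(neg_root _) positive_neg_root simple_positive.
  by rewrite simple_refl_positive.
rewrite mulr1z positive_neg_root highest_positive neg_rootK.
have [->|at_] := eqVneq a theta.
  by rewrite -/(neg_root _) positive_neg_root highest_positive pairing_coroot.
by rewrite highest_pairing // subrr mulr0.
Qed.

(** If [lam] is the inverse image of [mu] under [w], then pairing [a] with [lam] is pairing [w(a)]
    with [mu]. The two sums of [ew_length] then merge, the summand 1 becoming the indicator of
    [w(a) < 0]. *)
Lemma ew_lengthE x : (ew_length x)%:Z = \sum_(a | rd_positive a)
  `|<< root_act (ew_lin x) a, ew_tr x >> + (~~ rd_positive (root_act (ew_lin x) a))%:Z|.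
Proof.
have wP := ew_linP x; rewrite /ew_length; set w := ew_lin x; set lam := symg_inv w _.
have pairE a : << root_act w a, ew_tr x >> = << a, lam >>.
  by rewrite -(root_actP a wP) /lam symg_invK.
have posE a : maps_pos w a = rd_positive (root_act w a).
  apply/existsP/idP => [[b /andP[bp /asboolP ab]]|ap].
    by rewrite (root_actE wP ab).
  by exists (root_act w a); rewrite ap /=; apply/asboolP/root_actP.
have negE a : maps_neg w a = ~~ rd_positive (root_act w a).
  apply/existsP/idP => [[b /andP[bp /asboolP ab]]|ap].
    by rewrite (root_actE wP ab) -negative_positiveN.
  by exists (root_act w a); rewrite negative_positiveN ap /=; apply/asboolP/root_actP.
rewrite [RHS](bigID (fun a => ~~ rd_positive (root_act w a))) /= PoszD.
rewrite !(big_morph Posz PoszD erefl) /=.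
congr (_ + _); apply: eq_big => a; rewrite ?negE ?posE ?negbK // => /andP[_ aw].
  by rewrite pairE aw.
by rewrite pairE aw addr0.
Qed.

(** * Length change under right multiplication by a simple affine reflection *)

Definition regular_dominant y := forall a, rd_positive a -> 1 <= << a, y >>.

(** Regularity opens the absolute values: where [w(a)] is negative, its opposite pairs with [y] to
    at least 1, so the extra 1 lowers the absolute value by 1. What remains is [root_sign] times the
    pairing, an even function of the root, so applying [w] does not change its sum. *)
Lemma ew_length_dominant x : regular_dominant (ew_tr x) ->
  (ew_length x)%:Z = \sum_(a | rd_positive a) << a, ew_tr x >>
    - \sum_(a | rd_positive a) (~~ rd_positive (root_act (ew_lin x) a))%:Z.
Proof.
move=> xdom; rewrite ew_lengthE; set w := ew_lin x; set y := ew_tr x.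
have even a : root_sign (neg_root a) * << neg_root a, y >> = root_sign a * << a, y >>.
  by rewrite root_sign_neg pairing_neg_root mulrNN.
transitivity (\sum_(a | rd_positive a) root_sign a * << a, y >> -
   \sum_(a | rd_positive a) (~~ rd_positive (root_act w a))%:Z); last first.
  by congr (_ - _); apply: eq_bigr => a ap; rewrite /root_sign ap mul1r.
rewrite -(sum_even_root_act (ew_linP x) even) -sumrB; apply: eq_bigr => a _.
rewrite -/w /root_sign; case: (boolP (rd_positive (root_act w a))) => [ap|].
  by have := xdom _ ap; rewrite -/y /=; lia.
rewrite -positive_neg_root => /xdom; rewrite pairing_neg_root -/y /=; lia.
Qed.

(** This is the change in the number of inversions under right multiplication by an arbitrary
    reflection. Twice the indicator of a negative root is 1 minus its sign, which turns the claim
    into an identity between sums of signs. *)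
Lemma sum_indicator_refl (w : symg (rd_cochar D)) a : rd_weyl w ->
  \sum_(b | rd_positive b) (~~ rd_positive (root_act (w * rd_refl a)%g b))%:Z =
  \sum_(b | rd_positive b) (~~ rd_positive (root_act w b))%:Z +
  \sum_(b | rd_positive b)
    root_sign (root_act w b) * (~~ rd_positive (root_act (rd_refl a) b))%:Z.
Proof.
move=> wP; have sP := refl_weyl a.
(* The factor [root_sign b] makes [f] even, so that its sum may be reindexed by the reflection. *)
pose f b := root_sign b * root_sign (root_act w (root_act (rd_refl a) b)).
have even b : f (neg_root b) = f b.
  by rewrite /f !root_act_neg // !root_sign_neg mulrNN.
have indE b : 2 * (~~ rd_positive b)%:Z = 1 - root_sign b.
  by rewrite /root_sign; case: rd_positive.
apply/eqP; rewrite addrC -subr_eq; apply/eqP/(@mulfI _ (2 : int)) => //.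
rewrite mulrBr !mulr_sumr -sumrB.
transitivity (\sum_(b | rd_positive b) root_sign (root_act w b) -
   \sum_(b | rd_positive b) f b).
  rewrite -sumrB; apply: eq_bigr => b bp; rewrite !indE root_actM // /f /root_sign bp.
  lia.
rewrite -(sum_even_root_act sP even) -sumrB; apply: eq_bigr => b _.
rewrite /f root_act_reflK mulrCA indE; lia.
Qed.

(** By [ew_length_dominant] the length changes by a translation term minus a change in inversions.
    Both are sums over positive roots weighted by the sign of [w(a)], and by [affine_refl_defect]
    their difference has a single nonzero term, at plus or minus [affine_root i]. *)
Lemma ew_length_mul_refl x i :
  regular_dominant (ew_tr x) -> regular_dominant (ew_tr (x * affine_refl theta i)%g) ->
  (ew_length (x * affine_refl theta i)%g)%:Z =
  (ew_length x)%:Z - root_sign (root_act (ew_lin x) (affine_root i)).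
Proof.
move=> xdom xsdom; rewrite !ew_length_dominant //.
set s := affine_refl theta i; set w := ew_lin x; have wP : rd_weyl w := ew_linP x.
rewrite -[ew_tr (x * s)%g]/(ew_tr x + w (ew_tr s)) -[ew_lin (x * s)%g]/(w * ew_lin s)%g.
set b := if rd_positive (affine_root i) then affine_root i else neg_root (affine_root i).
have bp : rd_positive b.
  by rewrite /b; case: ifP => // /negbT; rewrite positive_neg_root.
(* Moving [w] from the coroot side to the root side costs exactly the sign of [w(a)]. *)
have trE : \sum_(a | rd_positive a) << a, w (ew_tr s) >> =
    \sum_(a | rd_positive a) root_sign (root_act w a) * << a, ew_tr s >>.
  transitivity (\sum_(a | rd_positive a) root_sign a * << a, w (ew_tr s) >>).
    by apply: eq_bigr => a ap; rewrite /root_sign ap mul1r.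
  rewrite -(sum_even_root_act wP); last first.
    by move=> a; rewrite root_sign_neg pairing_neg_root mulrNN.
  by apply: eq_bigr => a _; rewrite (root_actP a wP).
under eq_bigr do rewrite raddfD.
rewrite big_split /= trE {2}/s affine_refl_lin sum_indicator_refl // -affine_refl_lin -/s.
set S1 := \sum_(_ | _) _; set S2 := \sum_(_ | _) _; set S3 := \sum_(_ | _) _.
set S4 := \sum_(_ | _) _.
(* [S2] is the translation term and [S4] the change in inversions. *)
suff -> : S2 = S4 - root_sign (root_act w (affine_root i)) by lia.
apply/eqP; rewrite addrC -subr_eq -sumrB; apply/eqP.
transitivity (\sum_(a | rd_positive a) root_sign (root_act w a) *
    (- root_sign (affine_root i) * (a == b)%:Z)).
  by apply: eq_bigr => a ap; rewrite -mulrBr affine_refl_defect.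
rewrite (bigD1 b) //= eqxx big1 => [|a /andP[_ /negPf ->]]; last by rewrite !mulr0.
rewrite /b /root_sign; case: (rd_positive (affine_root i)).
  by case: rd_positive.
by rewrite root_act_neg // positive_neg_root; case: rd_positive.
Qed.

(** The translation part of [s_i] is negated by its linear part, so each summand of [ew_lengthE] is
    the absolute value of the defect in [affine_refl_defect], which is 1 at one positive root and 0
    at the others. *)
Lemma ew_length_affine_refl i : ew_length (affine_refl theta i) = 1%N.
Proof.
set s := affine_refl theta i; suff: (ew_length s)%:Z = 1 by case.
rewrite ew_lengthE.
set b := if rd_positive (affine_root i) then affine_root i else neg_root (affine_root i).
have bp : rd_positive b.
  by rewrite /b; case: ifP => // /negbT; rewrite positive_neg_root.
have symE a : << root_act (ew_lin s) a, ew_tr s >> = - << a, ew_tr s >>.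
  rewrite /s affine_refl_lin affine_refl_tr /affine_const.
  case: unlift => [j|]; first by rewrite mulr0z !raddf0.
  rewrite mulr1z root_act_refl pairingDl pairingNl pairingMzl pairing_coroot; lia.
transitivity (\sum_(a | rd_positive a) (a == b)%:Z).
  apply: eq_bigr => a ap; have := affine_refl_defect i ap; rewrite -/s symE -/b.
  by rewrite /root_sign; case: (rd_positive (affine_root i)); lia.
by rewrite (bigD1 b) //= eqxx big1 // => a /andP[_ /negPf ->].
Qed.

Lemma affine_reflK i : (affine_refl theta i * affine_refl theta i)%g = 1%g.
Proof.
apply: ext_weyl_eqP; last first.
  by rewrite /= affine_refl_lin; apply: symg_eqP => y /=; rewrite refl_funK.
rewrite /= affine_refl_lin affine_refl_tr /affine_const.
case: unlift => [j|] /=; first by rewrite !mulr0z /refl_fun raddf0 mulr0z subrr addr0.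
by rewrite !mulr1z /refl_fun pairing_coroot mulrz_nat mulr2n opprD addNKr subrr.
Qed.

(** The [y0 l] are [d] times fundamental coweights, so their sum pairs with a positive root to [d]
    times its height. *)
Lemma pairing_scaled_coweights (y0 : 'I_(rd_ssrank D) -> rd_cochar D) (d : int) (N : nat) :
  0 < d -> (forall j l, << rd_simple j, y0 l >> = d * (j == l)%:Z) ->
  forall a, rd_positive a -> N%:Z <= << a, \sum_l y0 l *+ N >>.
Proof.
move=> d0 y0E a ap; rewrite raddf_sum.
have e l : << a, y0 l >> = d * root_coef a l.
  rewrite {1}root_coefE pairing_suml (bigD1 l) //= big1 => [|j /negPf jl].
    by rewrite pairingMzl y0E eqxx; lia.
  by rewrite pairingMzl y0E jl; lia.
have [l al] := positive_coef_gt0 ap; have ge0 := positive_coef_ge0 ap.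
rewrite (bigD1 l) //= -[leLHS]addr0; apply: lerD.
  by rewrite raddfMn /= e -mulr_natr natz ler_peMl //; nia.
by apply: sumr_ge0 => j _; rewrite raddfMn /= e mulrn_wge0 // mulr_ge0 ?ge0 // ltW.
Qed.

(** * Absorbing a word into a translation in the Hecke algebra *)

Section HeckeWalk.
Variables (k : comPzRingType) (q : k).
Local Notation T x e := (heckeT theta q x e).

Lemma heckeT_mul x z : ew_length (x * z)%g = (ew_length x + ew_length z)%N ->
  T x true * T z true = T (x * z)%g true.
Proof.
move=> xz; rewrite /heckeT -of_braidM; congr of_braid.
rewrite /braidT /pres_gen -[LHS]/(pres_mul _ _) pres_mulE.
by apply: pi_pres_eq; apply: pres_rel; exists x, z; split.
Qed.

(** If the length goes up, this is the braid relation for [x] and [s]. If it goes down, the braid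
    relation for [x * s] and [s] expresses [T_x], and cancelling [T_s] leaves the inverse letter. *)
Lemma heckeT_step x i :
  regular_dominant (ew_tr x) -> regular_dominant (ew_tr (x * affine_refl theta i)%g) ->
  T x true * T (affine_refl theta i) (~~ rd_positive (root_act (ew_lin x) (affine_root i))) =
  T (x * affine_refl theta i)%g true.
Proof.
move=> xdom xsdom; set s := affine_refl theta i.
have := ew_length_mul_refl xdom xsdom; rewrite /root_sign -/s.
have s1 : ew_length s = 1%N := ew_length_affine_refl i.
case: rd_positive => /= xs; last by apply: heckeT_mul; rewrite s1; lia.
have {1}<- : (x * s * s)%g = x by rewrite -mulgA affine_reflK mulg1.
rewrite -heckeT_mul; last first.
  by rewrite -mulgA affine_reflK mulg1 s1; lia.
by rewrite -mulrA heckeTV mulr1.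
Qed.

(** This is [Psi] with each sign read off from a root instead of from alcoves; see
    [Psi_walk_prod]. *)
Definition walk_prod n (s : n.-tuple 'I_(rd_ssrank D).+1) : hecke theta q :=
  \prod_(nu < n) T (affine_refl theta (tnth s nu))
    (~~ rd_positive (root_act (ew_lin (walk_prefix theta s nu)) (affine_root (tnth s nu)))).

Lemma heckeT_walk_prod n (s : n.-tuple 'I_(rd_ssrank D).+1) y :
  (forall m, (m <= n)%N -> regular_dominant (y + ew_tr (word_prod theta (take m s)))) ->
  T (translation y) true * walk_prod s = T (translation y * word_prod theta s)%g true.
Proof.
move=> ydom; have prefixS (nu : 'I_n) : word_prod theta (take nu.+1 s) =
    (word_prod theta (take nu s) * affine_refl theta (tnth s nu))%g.
  rewrite /word_prod (tnth_nth ord0) (take_nth ord0) ?size_tuple //.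
  by rewrite -cats1 big_cat big_seq1.
pose g m := T (translation y * word_prod theta (take m s))%g true.
have -> : T (translation y) true = g 0.
  by rewrite /g take0 /word_prod big_nil mulg1.
rewrite (prod_telescope (g := g)) => [|nu]; first by rewrite /g -{1}(size_tuple s) take_size.
rewrite /g prefixS mulgA -heckeT_step; last 2 first.
- exact: ydom (ltnW (ltn_ord nu)).
- by rewrite -mulgA -prefixS; apply: ydom (ltn_ord nu).
congr (_ * T _ (~~ rd_positive (root_act _ _))).
Qed.

Lemma walk_prod_eq n (s : n.-tuple 'I_(rd_ssrank D).+1) n' (s' : n'.-tuple 'I_(rd_ssrank D).+1) :
  (exists2 d : int, 0 < d & exists y0 : 'I_(rd_ssrank D) -> rd_cochar D,
     forall j l, << rd_simple j, y0 l >> = d * (j == l)%:Z) ->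
  word_prod theta s = word_prod theta s' -> walk_prod s = walk_prod s'.
Proof.
case=> d d0 [y0 y0E] ss'.
(* [bound t] dominates the pairings of all roots with the translation parts of all prefixes of [t].
   The extra 1 in [y] leaves a pairing of at least 1 with every positive root, for both words at
   once. *)
pose bound t := (\sum_(m < (size t).+1) \sum_(a : rd_roots D)
  absz << a, ew_tr (word_prod theta (take m t)) >>)%N.
pose y := \sum_l y0 l *+ (bound s + bound s').+1.
have ydom t m : (bound t <= bound s + bound s')%N -> (m <= size t)%N ->
    regular_dominant (y + ew_tr (word_prod theta (take m t))).
  move=> tb mt a ap; rewrite raddfD /=.
  have := pairing_scaled_coweights (bound s + bound s').+1 d0 y0E ap; rewrite -/y.
  have : (absz << a, ew_tr (word_prod theta (take m t)) >> <= bound t)%N.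
    rewrite /bound (bigD1 (Ordinal (mt : m < (size t).+1)%N)) //= (bigD1 a) //=.
    by rewrite -addnA leq_addr.
  lia.
have sE : T (translation y) true * walk_prod s = T (translation y * word_prod theta s)%g true.
  by apply: heckeT_walk_prod => m mn; apply: ydom; rewrite ?leq_addr ?size_tuple.
have s'E : T (translation y) true * walk_prod s' = T (translation y * word_prod theta s')%g true.
  by apply: heckeT_walk_prod => m mn; apply: ydom; rewrite ?leq_addl ?size_tuple.
(* The invertible element attached to [translation y] is cancelled on the left. *)
rewrite -[LHS]mul1r -[RHS]mul1r -(heckeTV theta q (translation y) false) -!mulrA.
by rewrite sE s'E ss'.
Qed.
End HeckeWalk.
End AffineLength.

(** * Geometry of the base alcove *)

Lemma common_denominator (I : finType) (f : I -> rat) :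
  exists2 d : int, 0 < d & exists g : I -> int, forall i, (g i)%:~R = d%:~R * f i.
Proof.
exists (\prod_i denq (f i)); first by apply: prodr_gt0 => i _; apply: denq_gt0.
exists (fun i => (\prod_(j | j != i) denq (f j)) * numq (f i)) => i.
rewrite [in RHS](bigD1 i) //= !intrM [_ * (\prod_(_ | _) _)%:~R]mulrC -mulrA.
by rewrite mulrC numqE mulrC [_ * f i]mulrC.
Qed.

(** Clearing denominators shows that the simple roots, independent over the integers, are
    independent over the rationals. Their matrix [M] in the basis [cobasis] thus has a rational
    right inverse, whose columns are the fundamental coweights; [d] clears their denominators. *)
Lemma scaled_fundamental_coweights (D : root_datum) :
  exists2 d : int, 0 < d & exists y0 : 'I_(rd_ssrank D) -> rd_cochar D,
    forall j l, rd_pairing (rd_root (rd_simple j)) (y0 l) = d * (j == l)%:Z.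
Proof.
pose M : 'M[rat]_(_, _) :=
  \matrix_(j, i) (rd_pairing (rd_root (@rd_simple D j)) (cobasis i))%:~R.
have Mfree : row_free M.
  rewrite -kermx_eq0; apply/rowV0P => u /sub_kermxP uM.
  have [d d0 [g gE]] := common_denominator (u 0).
  have g0 : \sum_j rd_root (@rd_simple D j) *~ g j = 0.
    apply: char_eqP => y; rewrite pairing0l pairing_suml -[y]cocoordK.
    under eq_bigr do rewrite pairingMzl raddf_sum mulr_suml.
    rewrite exchange_big /= big1 // => i _.
    suff : \sum_j rd_pairing (rd_root (@rd_simple D j)) (cobasis i) * g j = 0.
      move=> e; rewrite -[RHS](mul0r (cocoord y 0 i)) -[in RHS]e mulr_suml.
      by apply: eq_bigr => j _; rewrite raddfMz /= mulrzz mulrAC.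
    apply/eqP; rewrite -(intr_eq0 rat) rmorph_sum /=; apply/eqP.
    have /rowP/(_ i) := uM; rewrite !mxE => e.
    rewrite -[RHS](mulr0 d%:~R) -[in RHS]e mulr_sumr; apply: eq_bigr => j _.
    by rewrite intrM gE [M j i]mxE [RHS]mulrA [LHS]mulrC.
  apply/rowP => j; rewrite mxE; apply/eqP.
  have := gE j; rewrite (simple_free g0) => /esym/eqP.
  by rewrite mulf_eq0 intr_eq0 (gt_eqF d0).
have [d d0 [g gE]] := common_denominator (fun il => pinvmx M il.1 il.2).
exists d => //; exists (fun l => \sum_i cobasis i *~ g (i, l)) => j l.
apply: (intr_inj (R := rat)); rewrite raddf_sum rmorph_sum rmorphM /=.
have /matrixP/(_ j l) := mulmxVp Mfree; rewrite !mxE => e.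
rewrite -[(j == l)%:Z%:~R]/((j == l)%:R) -e mulr_sumr; apply: eq_bigr => i _.
by rewrite raddfMz /= mulrzz intrM gE [M j i]mxE mulrCA.
Qed.

(** * The pairing and the affine action over the reals *)

Section RealPairing.
Variables (D : root_datum) (R : realType).
Implicit Types (a b : rd_roots D) (x : ext_weyl D) (p : 'rV[R]_(rd_rank D)).
Local Notation "<< a , p >>" := (real_pairing (rd_root a) p).
Local Open Scope classical_set_scope.

(** Each entry is affine in [t], and a neighbourhood of a matrix contains a finite product of
    neighbourhoods of its entries. *)
Lemma row_line_continuous n (p u : 'rV[R]_n) : continuous (fun t : R => p + t *: u).
Proof.
have e i j s : (p + s *: u) i j = p i j + s * u i j by rewrite !mxE.
have cont i j : continuous (fun s : R => (p + s *: u) i j).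
  rewrite (_ : (fun s : R => _) = (fun s => p i j + s * u i j)); last exact/funext.
  by move=> s; apply: cvgD; [exact: cvg_cst|apply: cvgMr_tmp; exact: cvg_id].
move=> t A [P ptP PA]; apply: filterS; first by move=> s; apply: PA.
apply: (@filter_forall _ _ (fun i s => forall j, P i j ((p + s *: u) i j)) (nbhs t)) => i.
apply: (@filter_forall _ _ (fun j s => P i j ((p + s *: u) i j)) (nbhs t)) => j.
exact: cont (ptP i j).
Qed.

Lemma real_pairing_continuous (c : rd_char D) :
  continuous (fun p : 'rV[R]_(rd_rank D) => real_pairing c p).
Proof.
apply: continuous_big => [|i _ p]; first exact: add_continuous.
exact: (cvgMr_tmp (@coord_continuous _ _ _ 0 i p)).
Qed.

Lemma real_pairingDr (c : rd_char D) p p' :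
  real_pairing c (p + p') = real_pairing c p + real_pairing c p'.
Proof. by rewrite -big_split; apply: eq_bigr => i _; rewrite mxE mulrDl. Qed.

Lemma real_pairingZ (c : rd_char D) t p :
  real_pairing c (t *: p) = t * real_pairing c p.
Proof. by rewrite mulr_sumr; apply: eq_bigr => i _; rewrite mxE mulrA. Qed.

Lemma real_pairing0 (c : rd_char D) : real_pairing c (0 : 'rV[R]_(rd_rank D)) = 0.
Proof. by rewrite -(scale0r 0) real_pairingZ mul0r. Qed.

Lemma real_pairing_line (c : rd_char D) t p p' :
  real_pairing c (p + t *: (p' - p)) = (1 - t) * real_pairing c p + t * real_pairing c p'.
Proof.
by rewrite real_pairingDr real_pairingZ -scaleN1r real_pairingDr real_pairingZ; ring.
Qed.

Lemma real_pairing_cochar (c : rd_char D) (y : rd_cochar D) :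
  real_pairing c (real_cochar R y) = (rd_pairing c y)%:~R.
Proof.
rewrite -{2}[y]cocoordK raddf_sum rmorph_sum; apply: eq_bigr => i _.
by rewrite mxE raddfMz /= mulrzz intrM mulrC.
Qed.

Lemma real_pairing_rootE a p :
  << a, p >> = \sum_l (root_coef a l)%:~R * << rd_simple l, p >>.
Proof.
transitivity (\sum_i \sum_l (root_coef a l)%:~R *
    (p 0 i * (rd_pairing (rd_root (rd_simple l)) (cobasis i))%:~R)).
  apply: eq_bigr => i _; rewrite {1}root_coefE pairing_suml rmorph_sum mulr_sumr.
  by apply: eq_bigr => l _; rewrite pairingMzl /= intrM [LHS]mulrA [LHS]mulrC.
by rewrite exchange_big; apply: eq_bigr => l _; rewrite mulr_sumr.
Qed.

Lemma real_pairing_neg a p : << neg_root a, p >> = - << a, p >>.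
Proof.
rewrite -sumrN; apply: eq_bigr => i _.
by rewrite pairing_neg_root mulrNz mulrN.
Qed.

Lemma real_pairing_act x a p : << root_act (ew_lin x) a, act x p >> =
  (rd_pairing (rd_root (root_act (ew_lin x) a)) (ew_tr x))%:~R + << a, p >>.
Proof.
rewrite real_pairingDr real_pairing_cochar; congr (_ + _).
rewrite /real_pairing; under eq_bigr do rewrite /real_ext summxE mulr_suml.
rewrite exchange_big; apply: eq_bigr => i _ /=.
rewrite -(root_actP a (ew_linP x)) -real_pairing_cochar -real_pairingZ.
by [].
Qed.

Lemma cocoord_is_additive : {morph @cocoord D : y z / y - z}.
Proof.
move=> y z; rewrite -[RHS]cobasisK; congr cocoord.
rewrite -{1}[y]cocoordK -{1}[z]cocoordK -sumrB; apply: eq_bigr => i _.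
by rewrite !mxE mulrzBr.
Qed.

HB.instance Definition _ :=
  GRing.isZmodMorphism.Build (rd_cochar D) 'rV[int]_(rd_rank D) (@cocoord D)
    cocoord_is_additive.

Lemma real_cochar_is_additive : {morph @real_cochar D R : y z / y - z}.
Proof. by move=> y z; rewrite /real_cochar raddfB map_mxB. Qed.

HB.instance Definition _ :=
  GRing.isZmodMorphism.Build (rd_cochar D) 'rV[R]_(rd_rank D) (@real_cochar D R)
    real_cochar_is_additive.

Lemma real_ext_refl a p : real_ext (rd_refl a) p = p - << a, p >> *: real_cochar R (rd_coroot a).
Proof.
(* Since [real_ext] is defined on the basis, it suffices to know that [cobasis] becomes the standard
   basis. *)
have cobE i : real_cochar R (@cobasis D i) = delta_mx 0 i.
  apply/rowP => j; have := cobasisK (delta_mx 0 i : 'rV[int]_(rd_rank D)).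
  rewrite (bigD1 i) //= mxE !eqxx mulr1z big1 => [|l /negPf li]; last by rewrite mxE li andbF mulr0z.
  by rewrite addr0 => e; rewrite mxE e !mxE; case: (_ && _).
rewrite [X in _ = X - _]row_sum_delta /real_pairing scaler_suml -sumrB.
apply: eq_bigr => i _; rewrite -cobE -scalerA -scalerBr; congr (_ *: _).
by rewrite /= /refl_fun raddfB raddfMz scaler_int.
Qed.

End RealPairing.

(** * The base alcove, cut out by the simple affine roots *)

Section BaseAlcove.
Variables (D : root_datum) (D_reduced : rd_reduced D).
Variables (theta : rd_roots D) (theta_highest : is_highest_root theta).
Variable R : realType.
Implicit Types (a b : rd_roots D) (x : ext_weyl D) (p : 'rV[R]_(rd_rank D))
  (i : 'I_(rd_ssrank D).+1) (A B : set 'rV[R]_(rd_rank D)).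
Local Notation "<< a , p >>" := (real_pairing (rd_root a) p).
Local Open Scope classical_set_scope.

Definition affine_form i p : R := << affine_root theta i, p >> + (affine_const i)%:~R.

Definition open_alcove : set 'rV[R]_(rd_rank D) := [set p | forall i, 0 < affine_form i p].

Lemma affine_form0 p : affine_form ord0 p = 1 - << theta, p >>.
Proof.
by rewrite /affine_form /affine_root /affine_const unlift_none real_pairing_neg addrC.
Qed.

Lemma affine_form_lift j p : affine_form (lift ord0 j) p = << rd_simple j, p >>.
Proof. by rewrite /affine_form /affine_root /affine_const liftK addr0. Qed.

Lemma affine_form_line i t p p' :
  affine_form i (p + t *: (p' - p)) = (1 - t) * affine_form i p + t * affine_form i p'.
Proof. by rewrite /affine_form real_pairing_line; ring. Qed.

(** The coordinates of [a] lie between 0 and those of [theta], and [theta] is below 1 on the open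
    alcove. *)
Lemma positive_bounds p a : open_alcove p -> rd_positive a -> 0 < << a, p >> < 1.
Proof.
move=> pC ap; have simple_gt0 j : 0 < << rd_simple j, p >>.
  by have := pC (lift ord0 j); rewrite affine_form_lift.
apply/andP; split.
  have [l al] := positive_coef_gt0 ap; rewrite real_pairing_rootE (bigD1 l) //=.
  apply: ltr_pwDl; first by rewrite mulr_gt0 ?ltr0z.
  apply: sumr_ge0 => j _; rewrite mulr_ge0 ?(ltW (simple_gt0 j)) //.
  by rewrite ler0z positive_coef_ge0.
have := pC ord0; rewrite affine_form0 subr_gt0; apply: le_lt_trans.
rewrite [leLHS]real_pairing_rootE [leRHS]real_pairing_rootE.
apply: ler_sum => j _; rewrite ler_wpM2r ?(ltW (simple_gt0 j)) //.
by rewrite ler_int root_coef_highest.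
Qed.

Lemma open_alcove_hyperplanes : open_alcove `<=` ~` hyperplanes (R := R).
Proof.
move=> p pC [a [j]]; rewrite /hyperplane /=.
case: (boolP (rd_positive a)) => [ap|]; last first.
  rewrite -positive_neg_root => /(positive_bounds pC); rewrite real_pairing_neg.
  move=> + e; rewrite e -rmorphN /= ltr0z -[1]/(1%:~R) ltr_int; lia.
move/(positive_bounds pC): ap => + e.
rewrite e ltr0z -[1]/(1%:~R) ltr_int; lia.
Qed.

(** The open alcove is convex, so the segment between the two points avoids all hyperplanes. *)
Lemma segment_sub_component p p' : open_alcove p -> open_alcove p' ->
  connected_component (~` hyperplanes (R := R)) p p'.
Proof.
move=> pC p'C; pose f (t : R) := p + t *: (p' - p).
have f0 : f 0 = p by rewrite /f scale0r addr0.
have f1 : f 1 = p' by rewrite /f scale1r addrC subrK.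
have sub : (f @` `[0, 1]) `<=` ~` hyperplanes (R := R).
  move=> _ [t /= t01 <-]; apply: open_alcove_hyperplanes => i.
  move: t01; rewrite in_itv /= => /andP[t0 t1].
  rewrite affine_form_line; have := pC i; have := p'C i; nra.
have conn : connected (f @` `[0, 1]).
  apply: connected_continuous_connected; first exact: segment_connected.
  by apply: continuous_subspaceT; exact: row_line_continuous.
apply: (connected_component_max _ sub conn).
  by exists 0 => //=; rewrite in_itv /= lexx ler01.
by exists 1 => //=; rewrite in_itv /= lexx ler01.
Qed.

(** On the connected set [A0] the highest root never takes the value 1, and it is below 1 near the
    origin, so it is below 1 throughout. The converse inclusion follows from convexity of the open
    alcove. *)
Lemma base_alcoveE (A0 : set 'rV[R]_(rd_rank D)) : is_base_alcove A0 -> A0 = open_alcove.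
Proof.
case=> -[p0 p0H A0E] A0dom A00.
have cont : continuous (fun p => << theta, p >>) by exact: real_pairing_continuous.
have [p1 [A0p1 p1lt]] : A0 `&` [set p | << theta, p >> < 1] !=set0.
  apply: A00; apply: (cont 0 [set t | t < 1]).
  by rewrite real_pairing0; apply: lt_nbhsl; exact: ltr01.
have A0sub : A0 `<=` open_alcove.
  move=> p A0p i; case: (unliftP ord0 i) => [j ->|->].
    by rewrite affine_form_lift; apply: A0dom.
  rewrite affine_form0 subr_gt0 ltNge; apply/negP => p_ge1.
  have conn : connected ((fun p => << theta, p >>) @` A0).
    apply: connected_continuous_connected; first by rewrite A0E; exact: component_connected.
    exact: continuous_subspaceT.
  (* The image of [A0] is an interval, so it would contain 1, and [A0] would meet a hyperplane. *)
  have [//|||p2 A0p2 p2E] := (connected_intervalP _).1 conn << theta, p1 >> << theta, p >> _ _ 1.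
  - by exists p1.
  - by exists p.
  - by rewrite (ltW p1lt) p_ge1.
  have : (~` hyperplanes (R := R)) p2 by move: A0p2; rewrite A0E; exact: connected_component_sub.
  by apply; exists theta, 1.
apply/seteqP; split=> // p pC; rewrite A0E.
have A0p0 : A0 p0 by rewrite A0E; exact: connected_component_refl.
exact: segment_sub_component (A0sub _ A0p0) pC.
Qed.

(** A small move from [p] towards the interior point [p0] makes all the forms positive. *)
Lemma open_alcove_closure p0 p : open_alcove p0 -> (forall i, 0 <= affine_form i p) ->
  closure open_alcove p.
Proof.
move=> p0C p_ge0 A pA.
have := @row_line_continuous R _ p (p0 - p) 0; rewrite /continuous_at scale0r addr0.
move=> /(_ A pA)/nbhs_ballP[e /= e0 eA].
pose t : R := Num.min (e / 2) (1 / 2).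
have t0 : 0 < t by rewrite lt_min !divr_gt0.
have te : t < e by rewrite gt_min; apply/orP; left; lra.
have t1 : t < 1 by rewrite gt_min; apply/orP; right; lra.
exists (p + t *: (p0 - p)); split.
  by move=> i; rewrite affine_form_line; have := p0C i; have := p_ge0 i; nra.
by apply: eA; rewrite /ball /= sub0r normrN gtr0_norm.
Qed.

(** The vertices are the origin and the fundamental coweights divided by the corresponding
    coordinates of [theta], a scaling that puts them on the hyperplane where [theta] is 1. *)
Lemma alcove_vertex i : exists p, 0 <= affine_form i p /\
  forall i', i' != i -> affine_form i' p = 0.
Proof.
case: (unliftP ord0 i) => [l ->|->]; last first.
  exists 0; split; first by rewrite affine_form0 real_pairing0 subr0.
  move=> i'; case: (unliftP ord0 i') => [j ->|-> /eqP//] _.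
  by rewrite affine_form_lift real_pairing0.
have [d d0 [y0 y0E]] := scaled_fundamental_coweights D.
have m0 := root_coef_highest_gt0 theta_highest l.
pose p : 'rV[R]_(rd_rank D) := (d%:~R * (root_coef theta l)%:~R)^-1 *: real_cochar R (y0 l).
have pE a : << a, p >> = (root_coef a l)%:~R / (root_coef theta l)%:~R.
  rewrite real_pairing_rootE (bigD1 l) //= big1 => [|j /negPf jl].
    rewrite /p real_pairingZ real_pairing_cochar y0E eqxx mulr1 addr0.
    by field; rewrite !intr_eq0 !gt_eqF.
  by rewrite /p real_pairingZ real_pairing_cochar y0E jl mulr0 !mulr0.
exists p; rewrite affine_form_lift pE root_coef_simple eqxx; split.
  by rewrite divr_ge0 ?ler0z // ltW.
move=> i'; case: (unliftP ord0 i') => [j ->|-> _].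
  rewrite (inj_eq lift_inj) => /negPf jl.
  by rewrite affine_form_lift pE root_coef_simple jl mul0r.
by rewrite affine_form0 pE divff ?subrr // intr_eq0 gt_eqF.
Qed.

End BaseAlcove.

(** * Walls of alcoves and the signs of a walk *)

Section Walls.
Variables (D : root_datum) (D_reduced : rd_reduced D).
Variables (theta : rd_roots D) (theta_highest : is_highest_root theta).
Variables (R : realType) (A0 : set 'rV[R]_(rd_rank D)) (A0_base : is_base_alcove A0).
Implicit Types (a b : rd_roots D) (x : ext_weyl D) (p : 'rV[R]_(rd_rank D))
  (i : 'I_(rd_ssrank D).+1).
Local Notation "<< a , p >>" := (real_pairing (rd_root a) p).
Local Notation form := (affine_form theta).
Local Open Scope classical_set_scope.

(** The reflection [s_i] negates its affine root, so that form vanishes at a fixed point.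
    Conversely, the displacement of [p] is the form times a coroot. *)
Lemma act_affine_refl_fix i p : act (affine_refl theta i) p = p <-> form i p = 0.
Proof.
split=> [fixp|]; last first.
  rewrite /act affine_refl_tr affine_refl_lin real_ext_refl.
  case: (unliftP ord0 i) => [j ->|->].
    rewrite affine_form_lift /affine_const !liftK => ->.
    by rewrite mulr0z raddf0 scale0r subr0 add0r.
  rewrite affine_form0 /affine_const !unlift_none mulr1z => /subr0_eq <-.
  by rewrite scale1r addrC subrK.
have := real_pairing_act (affine_refl theta i) (affine_root theta i) p.
rewrite fixp root_act_affine_root pairing_neg_root affine_refl_tr raddfMz /=.
rewrite real_pairing_neg /affine_form /affine_root /affine_const.
case: unlift => [j|]; first by rewrite mulr0z oppr0; lra.
by rewrite pairing_neg_root pairing_coroot real_pairing_neg mulr1z; lra.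
Qed.

Lemma faceE x i : face theta A0 x i = act x @` (closure A0 `&` [set p | form i p = 0]).
Proof.
by congr (_ @` (_ `&` _)); apply/seteqP; split=> p /act_affine_refl_fix.
Qed.

Lemma closure_form_ge0 p : (forall i, 0 <= form i p) -> closure A0 p.
Proof.
have A0E := base_alcoveE theta_highest A0_base; have [[p0 p0H A0c] _ _] := A0_base.
have : A0 p0 by rewrite A0c; exact: connected_component_refl.
by rewrite A0E => p0C p_ge0; exact: open_alcove_closure p0C p_ge0.
Qed.

Lemma root_act_surj x a : exists b, a = root_act (ew_lin x) b.
Proof.
exists (root_act (ew_lin x)^-1%g a).
rewrite -root_actM ?mulgV ?root_act1 //; [exact: ew_linP|exact: (gen_subgroup_inv (ew_linP x))].
Qed.

(** The face of type [i] contains every vertex of the alcove except the opposite one. The common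
    value [m] of [a] at these vertices makes [a] proportional to [affine_root i], and reducedness
    leaves only the two signs. *)
Lemma face_sub_hyperplaneE x i a j :
  face theta A0 x i `<=` hyperplane (R := R) (root_act (ew_lin x) a) j <->
  (a = affine_root theta i /\ j = rd_pairing (rd_root (root_act (ew_lin x) a)) (ew_tr x) - affine_const i) \/
  (a = neg_root (affine_root theta i) /\
     j = rd_pairing (rd_root (root_act (ew_lin x) a)) (ew_tr x) + affine_const i).
Proof.
rewrite faceE; set c := rd_pairing _ _; split; last first.
  move=> aj _ [p [_ /=] + <-]; rewrite /hyperplane /= real_pairing_act -/c /affine_form.
  by case: aj => -[-> ->] /=; rewrite ?real_pairing_neg ?rmorphB ?rmorphD /=; lra.
move=> sub; pose m := j - c.
have vertex l p : l != i -> 0 <= form l p -> (forall l', l' != l -> form l' p = 0) ->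
    << a, p >> = m%:~R.
  move=> li pl pl'; have := sub (act x p); rewrite /hyperplane /= real_pairing_act -/c.
  rewrite /m rmorphB /= => <-; first by ring.
  exists p => //; split; last by apply: pl'; rewrite eq_sym.
  apply: closure_form_ge0 => l'; have [->//|l'l] := eqVneq l' l.
  by rewrite pl'.
suff : (a = affine_root theta i /\ m = - affine_const i) \/
       (a = neg_root (affine_root theta i) /\ m = affine_const i).
  by case=> -[-> mE]; [left|right]; split=> //; rewrite -mE /m; ring.
(* At this vertex only the [l]-th simple root can be nonzero. Comparing the value [m] of [a] there
   with the value 1 of [theta] gives the coordinate. *)
have coefE l p : lift ord0 l != i -> 0 <= form (lift ord0 l) p ->
    (forall l', l' != lift ord0 l -> form l' p = 0) ->
    root_coef a l = root_coef theta l * m.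
  move=> li pl pl'; have am := vertex _ _ li pl pl'.
  have pair b : << b, p >> = (root_coef b l)%:~R * form (lift ord0 l) p.
    rewrite real_pairing_rootE (bigD1 l) //= big1 => [|j0 j0l].
      by rewrite addr0 affine_form_lift.
    by rewrite -(affine_form_lift theta) pl' ?mulr0 // (inj_eq lift_inj).
  have t1 : << theta, p >> = 1.
    by have := pl' ord0 isT; rewrite affine_form0 => /subr0_eq.
  apply/eqP; rewrite -(eqr_int R) intrM -am pair; apply/eqP.
  by rewrite mulrCA -pair t1 mulr1.
have coefE' l : lift ord0 l != i -> root_coef a l = root_coef theta l * m.
  by move=> li; have [p [pl pl']] := alcove_vertex theta_highest R (lift ord0 l); exact: coefE pl pl'.
rewrite /affine_root /affine_const; case: (unliftP ord0 i) => [l iE|iE].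
  (* For a finite type the origin lies on the face, which forces [m = 0]; all coordinates but the
     [l]-th then vanish. *)
  have m0 : m = 0.
    have [p [p0 p0']] := alcove_vertex theta_highest R ord0.
    have := vertex ord0 0; rewrite iE real_pairing0 => /(_ isT) e.
    apply/eqP; rewrite -(intr_eq0 R) -e //; first by rewrite affine_form0 real_pairing0 subr0.
    move=> l'; case: (unliftP ord0 l') => [j0 ->|-> /eqP//] _.
    by rewrite affine_form_lift real_pairing0.
  have aE : rd_root a *~ 1 = rd_root (rd_simple l) *~ root_coef a l.
    rewrite mulr1z {1}root_coefE (bigD1 l) //= big1 ?addr0 // => l' l'l.
    by rewrite coefE' ?m0 ?mulr0 // iE (inj_eq lift_inj).
  rewrite m0; have [] := D_reduced _ aE => // [/root_inj ->|]; first by left.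
  by rewrite -neg_rootE => /root_inj ->; right; rewrite neg_rootK.
have aE : rd_root a *~ 1 = rd_root theta *~ m.
  rewrite mulr1z root_coefE [in RHS]root_coefE mulrz_suml; apply: eq_bigr => l _.
  by rewrite -mulrzA coefE' // iE.
(* Here [a] is [m] times [theta]; pairing with the coroot of [theta] determines [m] once the sign of
   [a] is known. *)
have m2 : rd_pairing (rd_root a) (rd_coroot theta) = 2 * m.
  by rewrite -[rd_root a]mulr1z aE pairingMzl pairing_coroot.
have [//|/root_inj tE|] := D_reduced _ aE.
  right; rewrite neg_rootK tE; split=> //.
  by move: m2; rewrite tE pairing_coroot; lia.
rewrite -neg_rootE => /root_inj tE; left; split; first by rewrite tE neg_rootK.
by have := pairing_coroot theta; rewrite {1}tE pairing_neg_root m2; lia.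
Qed.

(** The affine form of type [i], transported by [x], is positive on [x A0] and has gradient [w(c)].
    If [w(c)] is positive, [x A0] lies above its wall while [B] lies below. If it is negative, the
    wall has to be written with the opposite root, and both lie below. *)
Lemma same_side_wallE x i B : B !=set0 ->
  (forall a j, is_wall theta A0 x i a j -> B `<=` below a j) ->
  same_side_wall theta A0 x i B =
  ~~ rd_positive (root_act (ew_lin x) (affine_root theta i)).
Proof.
move=> [p Bp] far; have A0E := base_alcoveE theta_highest A0_base.
have form_gt0 p' : A0 p' -> 0 < form i p' by rewrite A0E; apply.
set c := affine_root theta i; set w := ew_lin x.
apply/asboolP/idP => [[a [j [wall side]]]|]; last first.
  rewrite -positive_neg_root -root_act_neg; last exact: ew_linP.
  move=> cp; exists (root_act w (neg_root c)).
  pose j := rd_pairing (rd_root (root_act w (neg_root c))) (ew_tr x) + affine_const i.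
  have wall : is_wall theta A0 x i (root_act w (neg_root c)) j.
    by split=> //; apply/face_sub_hyperplaneE; right.
  exists j; split=> //; left; split; last exact: far.
  move=> _ [p' /form_gt0 p'_gt0 <-]; rewrite /below /= real_pairing_act real_pairing_neg.
  by move: p'_gt0; rewrite /affine_form -/c /j rmorphD /=; lra.
have Bbelow := far _ _ wall; move: wall => [ap].
have [b aE] := root_act_surj x a; rewrite aE.
(* The positive root of the wall is [w(c)] or its opposite. In the second case [w(c)] is negative,
   as claimed; the first contradicts [side]. *)
case/face_sub_hyperplaneE => -[bE jE]; last first.
  by rewrite -positive_neg_root -root_act_neg ?aE ?bE // in ap *; exact: ew_linP.
have [[p0 p0H A0c] _ _] := A0_base.
have A0p0 : A0 p0 by rewrite A0c; exact: connected_component_refl.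
case: side => -[Aside Bside].
  have := Aside (act x p0) (ex_intro2 _ _ p0 A0p0 erefl).
  have := form_gt0 _ A0p0; rewrite /below /= aE real_pairing_act jE rmorphB /= /affine_form -bE.
  lra.
by have := Bside _ Bp; have := Bbelow _ Bp; rewrite /below /above /=; lra.
Qed.

Lemma Psi_walk_prod n (s : n.-tuple 'I_(rd_ssrank D).+1) B (k : comPzRingType) (q : k) :
  alcove B -> far_antidominant theta A0 s B -> Psi theta A0 s B q = walk_prod theta q s.
Proof.
move=> [p pH BE] far; apply: eq_bigr => nu _; rewrite same_side_wallE //; last exact: far.
by exists p; rewrite BE; exact: connected_component_refl.
Qed.

End Walls.

Theorem theorem1p1p1 (D : root_datum) (D_reduced : rd_reduced D)
  (D_irreducible : rd_irreducible D)
  (alpha0 : rd_roots D) (alpha0_highest : is_highest_root alpha0)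
  (R : realType) (A0 : set 'rV[R]_(rd_rank D)) (A0_base : is_base_alcove A0)
  (k : comPzRingType) (v : k) (v_invertible : exists v' : k, v * v' = 1)
  (w : ext_weyl D) (w_affine : affine_weyl alpha0 w)
  (n : nat) (s : n.-tuple 'I_(rd_ssrank D).+1) (s_w : w = word_prod alpha0 s)
  (b : set 'rV[R]_(rd_rank D)) (b_alcove : alcove b)
  (b_far : far_antidominant alpha0 A0 s b)
  (n' : nat) (s' : n'.-tuple 'I_(rd_ssrank D).+1) (s'_w : w = word_prod alpha0 s')
  (b' : set 'rV[R]_(rd_rank D)) (b'_alcove : alcove b')
  (b'_far : far_antidominant alpha0 A0 s' b') :
  Psi alpha0 A0 s b (v ^+ 2) = Psi alpha0 A0 s' b' (v ^+ 2).
Proof.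
(* Once [b] and [b'] are eliminated from the signs, both sides are walk products of words for the
   same element. *)
rewrite !Psi_walk_prod //; apply: walk_prod_eq => //; last by rewrite -s_w -s'_w.
exact: scaled_fundamental_coweights.
Qed.
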